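(* Fix $\beta>0$ and $h\in\mathbb{R}$, and suppose there is a number $q$ with $0<q<1$ and a constant $C_0$ depending only on $\beta,h$ such that for every $N$, $$\mathbb{E}\langle (R_{12}-q)^4\rangle \le \frac{C_0}{N^2}.$$ For $1\le i\le N$ let $r_i := \frac{1}{\sqrt N}\sum_{j\ne i} g_{ij}\langle\sigma_j\rangle - \beta(1-q)\langle\sigma_i\rangle$, and let $z$ be a standard Gaussian random variable. Then there is a constant $C(\beta,h)$ depending only on $\beta,h$ (and the constants in the hypothesis) such that for every $N$, every $1\le i\le N$ and every bounded measurable $u:\mathbb{R}\to\mathbb{R}$, $$\bigl|\mathbb{E}u(r_i) - \mathbb{E}u(z\sqrt q)\bigr| \le \frac{C(\beta,h)\|u\|_\infty}{N^{1/4}}.$$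
   Context: Sherrington–Kirkpatrick model: for a positive integer $N$, let $\Sigma_N=\{-1,1\}^N$ and let $g=(g_{ij})_{1\le i<j\le N}$ be i.i.d. standard Gaussian random variables (the disorder); set $g_{ji}:=g_{ij}$. Given $g$, the Gibbs measure on $\Sigma_N$ is $G_N(\sigma)=Z_N^{-1}\exp\bigl(\frac{\beta}{\sqrt N}\sum_{1\le i<j\le N} g_{ij}\sigma_i\sigma_j + h\sum_{i=1}^N\sigma_i\bigr)$, with $Z_N$ the normalizing constant. Replicas $\sigma^1,\sigma^2,\dots$ are independent samples from $G_N$ given $g$, and $\langle\cdot\rangle$ denotes the quenched average (over replicas, $g$ fixed). $\mathbb{E}$ denotes expectation over the disorder. The overlap is $R_{12}=\frac1N\sum_{i=1}^N\sigma^1_i\sigma^2_i$. *)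

(* Defs.v *)
From HB Require Import structures.
From mathcomp Require Import all_boot all_order all_algebra.
From mathcomp Require Import all_classical all_reals all_analysis.
Set Implicit Arguments. Unset Strict Implicit. Unset Printing Implicit Defensive.
Import Order.TTheory GRing.Theory Num.Theory.
Import numFieldNormedType.Exports.
Local Open Scope classical_set_scope.
Local Open Scope ring_scope.

Section SK.
Variable R : realType.

Definition gauss_dens (x : R) : R := expR (- (x ^+ 2) / 2) / Num.sqrt (pi *+ 2).

Definition gaussE (F : R -> R) : R :=
  \int[@lebesgue_measure R]_(x in [set: R]) (gauss_dens x * F x).

(* disorder: g : 'I_N -> 'I_N -> R, only entries g i j with i < j are used;
   g_{ji} := g_{ij} *)
Definition gsym N (g : 'I_N -> 'I_N -> R) (i j : 'I_N) : R :=
  if (i < j)%N then g i j else g j i.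

Definition upd N (g : 'I_N -> 'I_N -> R) (p : 'I_N * 'I_N) (x : R) :=
  fun i j => if (i == p.1) && (j == p.2) then x else g i j.

Fixpoint gint N (s : seq ('I_N * 'I_N)) (F : ('I_N -> 'I_N -> R) -> R)
    (g : 'I_N -> 'I_N -> R) : R :=
  match s with
  | [::] => F g
  | p :: s' => gaussE (fun x => gint s' F (upd g p x))
  end.

Definition pairs N : seq ('I_N * 'I_N) :=
  [seq p : 'I_N * 'I_N <- [seq (i, j) | i <- enum 'I_N, j <- enum 'I_N] | (p.1 < p.2)%N].

(* expectation over the disorder (g_{ij})_{i<j} i.i.d. standard Gaussians *)
Definition disE N (F : ('I_N -> 'I_N -> R) -> R) : R :=
  gint (pairs N) F (fun _ _ => 0).

Definition spin N (s : {ffun 'I_N -> bool}) (i : 'I_N) : R :=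
  if s i then 1 else -1.

Definition hamil N (beta h : R) (g : 'I_N -> 'I_N -> R) (s : {ffun 'I_N -> bool}) : R :=
  beta / Num.sqrt (N%:R) *
    (\sum_(i < N) \sum_(j < N | (i < j)%N) g i j * spin s i * spin s j)
  + h * \sum_(i < N) spin s i.

Definition Zpart N beta h g : R :=
  \sum_(s : {ffun 'I_N -> bool}) expR (@hamil N beta h g s).

Definition gibbs N beta h g (s : {ffun 'I_N -> bool}) : R :=
  expR (@hamil N beta h g s) / Zpart beta h g.

Definition avg1 N beta h g (f : {ffun 'I_N -> bool} -> R) : R :=
  \sum_s gibbs beta h g s * f s.

Definition avg2 N beta h g (f : {ffun 'I_N -> bool} -> {ffun 'I_N -> bool} -> R) : R :=
  \sum_s1 \sum_s2 gibbs beta h g s1 * gibbs beta h g s2 * f s1 s2.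

Definition overlap N (s1 s2 : {ffun 'I_N -> bool}) : R :=
  (\sum_(i < N) spin s1 i * spin s2 i) / N%:R.

Definition cavity_r N beta h q g (i : 'I_N) : R :=
  (\sum_(j < N | j != i) gsym g i j * avg1 beta h g (fun s => spin s j))
    / Num.sqrt (N%:R)
  - beta * (1 - q) * avg1 beta h g (fun s => spin s i).

Definition supnorm (u : R -> R) : R := sup [set `|u x| | x in [set: R]].

End SK.

(* Main.v *)
(* Stein's method. For bounded continuous v let f solve f'(x) - x f(x) = v(x) - E v(z);
   f and f' are bounded by a multiple of sup |v|.  With Y = r_i / sqrt q, Gaussian
   integration by parts in the couplings g_ik gives

     E [f'(Y) - Y f(Y)] = E [f'(Y) (1 - D/q)] + (beta / sqrt q) E [f(Y) <s_i^1 (R_12 - q)>],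

   where D is an explicit Gibbs average.  Replacing the overlap R_12 by q throughout D
   leaves q + beta q V, where, with l = N^(-1/2) sum_k g_ik s_k,

     V = <l s_i> - <l><s_i> - beta (1 - q)(1 - <s_i>^2).

   Put e = N^(-1/4).  The fourth moment hypothesis makes every replacement cost O(e^2).
   A second integration by parts, in which the main terms cancel, gives E V^2 = O(e^2),
   hence E |V| = O(e), which is the stated rate.  The passage from continuous to
   measurable u is density of continuous functions in L^1 of the sum of the law of Y and
   the standard Gaussian law. *)
Require Import Defs.
From HB Require Import structures.
From mathcomp Require Import all_boot all_order all_algebra.
From mathcomp Require Import all_classical all_reals all_analysis.
From mathcomp Require Import measurable_realfun.
From mathcomp Require Import ring lra.
Import Order.TTheory GRing.Theory Num.Theory.
Import numFieldNormedType.Exports.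
Local Open Scope classical_set_scope.
Local Open Scope ring_scope.

Set Implicit Arguments. Unset Strict Implicit. Unset Printing Implicit Defensive.

(** * Gaussian integration by parts in one variable *)

(** The rate is limited by V alone. The other errors are, up to a 1/N term, linear in R_12 - q and
    integrated against observables that may contain the local field l, of which only the second
    moment is controlled. The weighted inequality |l (R_12 - q)| <= e^2 l^2 + (R_12 - q)^2 / (4 e^2)
    balances at order e^2, because the hypothesis yields E<(R_12 - q)^2> = O(e^4). V has no small
    factor pointwise: E V^2 inherits the order e^2, and passing to E|V| costs a square root.

    The formal obstacle is that [disE] is an iterated integral of plain functions, so neither
    linearity nor monotonicity comes with it. Both are obtained on the class of measurable functions
    of at most exponential growth, where [disE] is an expectation over a genuine probability space.
    This class contains the couplings, the Gibbs averages and their products, and supports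
    integration by parts. *)

Section Gauss.
Variable R : realType.
Local Notation mu := (@lebesgue_measure R).
Local Notation gam := (@normal_prob R 0 1).

Lemma gauss_densE : @gauss_dens R = normal_pdf 0 1.
Proof.
apply/funext => x; rewrite normal_pdfE ?oner_neq0// /gauss_dens /normal_peak /normal_fun.
by rewrite mulrC subr0 !expr1n mul1r.
Qed.

Lemma gauss_dens_gt0 (x : R) : 0 < gauss_dens x.
Proof.
by rewrite /gauss_dens divr_gt0 ?expR_gt0// sqrtr_gt0 mulrn_wgt0// pi_gt0.
Qed.

Lemma continuous_gauss_dens : continuous (@gauss_dens R).
Proof. by rewrite gauss_densE; apply: continuous_normal_pdf; rewrite oner_neq0. Qed.

Lemma measurable_gauss_dens : measurable_fun setT (@gauss_dens R).
Proof. exact: continuous_measurable_fun continuous_gauss_dens. Qed.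

(** The Radon-Nikodym derivative of the normal law is only determined almost everywhere; it is
    identified with [gauss_dens] because both have the same integral over every measurable set. *)
Lemma ge0_integral_gauss (f : R -> R) : measurable_fun setT f -> (forall x, 0 <= f x) ->
  (\int[gam]_x (f x)%:E = \int[mu]_x (gauss_dens x * f x)%:E)%E.
Proof.
move=> mf f0.
rewrite -(Radon_Nikodym_SigmaFinite.change_of_variables (normal_prob_dominates 0 1)) //=.
- apply: ae_eq_integral => //=.
  + apply: emeasurable_funM; first exact/measurable_EFinP.
    apply: (measurable_int mu); exact: (Radon_Nikodym_SigmaFinite.f_integrable (normal_prob_dominates 0 1)).
  + apply/measurable_EFinP; apply: measurable_funM => //; exact: measurable_gauss_dens.
  + under [X in ae_eq _ _ _ X]eq_fun do rewrite mulrC EFinM.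
    apply: ae_eqe_mul2l.
    apply: integral_ae_eq => //=.
    * exact: (Radon_Nikodym_SigmaFinite.f_integrable (normal_prob_dominates 0 1)).
    * apply/measurable_EFinP; exact: measurable_gauss_dens.
    * move=> A _ mA; rewrite -(Radon_Nikodym_SigmaFinite.f_integral (normal_prob_dominates 0 1))//.
      by rewrite /normal_prob gauss_densE.
- exact/measurable_EFinP.
Qed.

Lemma gauss_integrableP (f : R -> R) : measurable_fun setT f ->
  gam.-integrable setT (EFin \o f) <->
  mu.-integrable setT (fun x => (gauss_dens x * f x)%:E).
Proof.
move=> mf.
have mgf : measurable_fun setT (fun x => gauss_dens x * f x).
  by apply: measurable_funM => //; exact: measurable_gauss_dens.
have E : (\int[gam]_x `|(f x)%:E| = \int[mu]_x `|(gauss_dens x * f x)%:E|)%E.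
  under eq_integral do rewrite abse_EFin.
  rewrite ge0_integral_gauss//; last exact: measurableT_comp.
  apply: eq_integral => x _.
  by rewrite abse_EFin normrM (ger0_norm (ltW (gauss_dens_gt0 x))).
split=> /integrableP[_ h]; apply/integrableP; split.
- exact/measurable_EFinP.
- by rewrite -E.
- exact/measurable_EFinP.
- by rewrite /= E.
Qed.

(** The change of density is available for nonnegative functions, so positive and negative parts are
    transferred separately; multiplying by a positive density commutes with taking either part. *)
Lemma gaussE_int (f : R -> R) : measurable_fun setT f ->
  gam.-integrable setT (EFin \o f) -> gaussE f = \int[gam]_x f x.
Proof.
move=> mf intf; have intg := (gauss_integrableP mf).1 intf.
rewrite /gaussE /Rintegral; congr fine.
rewrite integralE [in RHS]integralE; congr (_ - _)%E.
- rewrite -[RHS](_ : (\int[gam]_x (Num.max (f x) 0)%:E)%E = _); last first.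
    by apply: eq_integral => x _; rewrite funeposE/= EFin_max.
  rewrite ge0_integral_gauss; last 2 first.
  + exact: measurable_maxr.
  + by move=> x; rewrite le_max lexx orbT.
  apply: eq_integral => x _; rewrite funeposE -EFin_max.
  by rewrite maxr_pMr ?mulr0// ltW// gauss_dens_gt0.
- rewrite -[RHS](_ : (\int[gam]_x (Num.max (- f x) 0)%:E)%E = _); last first.
    by apply: eq_integral => x _; rewrite funenegE/= EFin_max EFinN.
  rewrite ge0_integral_gauss; last 2 first.
  + by apply: measurable_maxr => //; exact: measurableT_comp.
  + by move=> x; rewrite le_max lexx orbT.
  apply: eq_integral => x _; rewrite funenegE -EFinN -EFin_max.
  by rewrite -mulrN maxr_pMr ?mulr0// ltW// gauss_dens_gt0.
Qed.

(** Since (a - |x|/2)^2 >= 0, a|x| - x^2/2 <= a^2 - x^2/4, the exponent of a normal law of variance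
    2. The factor sqrt 2 is the ratio of the two normalizations. *)
Lemma gauss_exp_bound (a x : R) :
  expR (a * `|x|) * gauss_dens x <= expR (a ^+ 2) * Num.sqrt 2 * normal_pdf 0 (Num.sqrt 2) x.
Proof.
have s20 : Num.sqrt 2 != 0 :> R by rewrite gt_eqF// sqrtr_gt0.
rewrite normal_pdfE// /normal_peak /normal_fun subr0 sqr_sqrtr// /gauss_dens.
have -> : 2 * pi *+ 2 = 2 * (pi *+ 2) :> R by ring.
rewrite sqrtrM// invfM.
set P := (Num.sqrt (pi *+ 2))^-1.
rewrite [leLHS](_ : _ = P * expR (a * `|x| + - x ^+ 2 / 2)); last by rewrite expRD; ring.
rewrite [leRHS](_ : _ = P * expR (a ^+ 2 + - x ^+ 2 / (2 *+ 2))); last by rewrite expRD; field.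
rewrite ler_wpM2l ?invr_ge0 ?sqrtr_ge0//.
rewrite ler_expR -subr_ge0.
have := sqr_ge0 (a - `|x| / 2); have := real_normK (num_real x); rewrite !expr2 => xx.
nra.
Qed.

Lemma gauss_exp_integrable (a : R) : gam.-integrable setT (fun x => (expR (a * `|x|))%:E).
Proof.
have mf : measurable_fun setT (fun x : R => expR (a * `|x|)).
  by apply: measurableT_comp => //; apply: measurable_funM => //; exact: measurableT_comp.
apply/gauss_integrableP => //.
have mg := measurable_gauss_dens.
apply: (@le_integrable _ _ _ mu _ _ _
   (fun x => (expR (a ^+ 2) * Num.sqrt 2 * normal_pdf 0 (Num.sqrt 2) x)%:E)) => //.
- by apply/measurable_EFinP; apply: measurable_funM.
- move=> x _; rewrite lee_fin; have := gauss_exp_bound a x; rewrite [in X in X -> _]mulrC => h.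
  by rewrite ger0_norm ?(le_trans h) ?ler_norm// mulr_ge0 ?expR_ge0// ltW// gauss_dens_gt0.
- under eq_fun do rewrite EFinM.
  by apply: integrableZl => //; exact: integrable_normal_pdf.
Qed.



Lemma gauss_growth_integrable (f : R -> R) (K a : R) : measurable_fun setT f ->
  (forall x, `|f x| <= K * expR (a * `|x|)) -> gam.-integrable setT (EFin \o f).
Proof.
move=> mf fK.
apply: (@le_integrable _ _ _ gam _ _ _ (fun x => (K * expR (a * `|x|))%:E)) => //.
- exact/measurable_EFinP.
- by move=> x _; rewrite lee_fin (le_trans (fK x))// ler_norm.
- under eq_fun do rewrite EFinM.
  by apply: integrableZl => //; exact: gauss_exp_integrable.
Qed.

Lemma gauss_exp_cvg0 (a : R) : (fun n : nat => expR (a * n%:R) * gauss_dens n%:R) @ \oo --> (0 : R).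
Proof.
(* The factor 4 comes from exp(n^2/4) >= 1 + n^2/4 >= (n+1)/4. *)
pose C := expR (a ^+ 2) * Num.sqrt 2 * normal_peak (Num.sqrt 2) * 4.
have C0 : 0 <= C by rewrite !mulr_ge0 ?expR_ge0 ?sqrtr_ge0 ?normal_peak_ge0.
apply: (@squeeze_cvgr _ _ _ _ (cst 0) (fun n => C * n.+1%:R^-1)); last 2 first.
- exact: cvg_cst.
- by rewrite -[X in _ --> X](mulr0 C); apply: cvgM; [exact: cvg_cst|exact: cvg_harmonic].
near=> n; rewrite mulr_ge0 ?expR_ge0 ?(ltW (gauss_dens_gt0 _))//=.
have := gauss_exp_bound a n%:R; rewrite ger0_norm// => /le_trans; apply.
have s20 : Num.sqrt 2 != 0 :> R by rewrite gt_eqF// sqrtr_gt0.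
rewrite normal_pdfE// /C /normal_fun -!mulrA.
do 3 (rewrite ler_wpM2l ?expR_ge0 ?sqrtr_ge0 ?normal_peak_ge0//).
rewrite subr0 sqr_sqrtr// mulNr expRN -[4]invrK -invfM lef_pV2 ?posrE ?expR_gt0 ?mulr_gt0//.
apply: le_trans (expR_ge1Dx _).
have -> : n.+1%:R = n%:R + 1 :> R by rewrite natr1.
have : 0 <= (n%:R - 1/2) ^+ 2 :> R by exact: sqr_ge0.
by move: (n%:R : R) => y; rewrite !expr2; lra.
Unshelve. all: by end_near. Qed.

Lemma is_derive_gauss_dens (x : R) : is_derive x 1 (@gauss_dens R) (- x * gauss_dens x).
Proof.
have d1 : is_derive x 1 (fun y : R => - (y ^+ 2) / 2) (- x).
  by apply: is_derive_eq; rewrite /GRing.scale /=; field.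
have d2 : is_derive x 1 (fun y : R => expR (- (y ^+ 2) / 2)) (expR (- (x ^+ 2) / 2) * - x).
  exact: (@is_derive1_comp _ expR (fun y : R => - (y ^+ 2) / 2)).
have d3 := is_deriveM d2 (is_derive_cst ((Num.sqrt (pi *+ 2 : R))^-1) x 1).
apply: (@is_derive_eq _ _ _ (@gauss_dens R) x 1 _ _ d3).
by rewrite /gauss_dens /GRing.scale /= mulr0 add0r; ring.
Qed.

(** F times the Gaussian density is a primitive of the density times F' - x F. Its increments over
    growing symmetric intervals tend to zero by the growth bound, and dominated convergence passes
    to the whole line. *)
Lemma gauss_ibp (F dF : R -> R) (K a : R) :
  (forall x : R, is_derive x 1 F (dF x)) -> continuous dF ->
  (forall x, `|F x| <= K * expR (a * `|x|)) ->
  (forall x, `|dF x| <= K * expR (a * `|x|)) ->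
  gaussE (fun x => x * F x) = gaussE dF.
Proof.
move=> FdF cdF FK dFK.
have cF : continuous F.
  by move=> x; apply: differentiable_continuous; apply/derivable1_diffP; case: (FdF x).
have mF : measurable_fun setT F by exact: continuous_measurable_fun.
have mdF : measurable_fun setT dF by exact: continuous_measurable_fun.
have mxF : measurable_fun setT (fun x : R => x * F x) by exact: measurable_funM.
have ixF : gam.-integrable setT (EFin \o (fun x : R => x * F x)).
  apply: (@gauss_growth_integrable _ K (a + 1)) => // x.
  rewrite normrM mulrDl mul1r expRD mulrA mulrC; apply: ler_pM => //.
  by rewrite (le_trans _ (expR_ge1Dx _))// lerDr.
have idF : gam.-integrable setT (EFin \o dF) by exact: gauss_growth_integrable dFK.
pose h x := gauss_dens x * dF x - gauss_dens x * (x * F x).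
have ih : mu.-integrable setT (EFin \o h).
  have := integrableB measurableT ((gauss_integrableP mdF).1 idF) ((gauss_integrableP mxF).1 ixF).
  by apply: eq_integrable.
suff h0 : \int[mu]_x h x = 0.
  apply/esym/eqP; rewrite -subr_eq0; apply/eqP; rewrite -[RHS]h0 /gaussE.
  rewrite -RintegralB//.
  + exact: ((gauss_integrableP mdF).1 idF).
  + exact: ((gauss_integrableP mxF).1 ixF).
have ch : continuous h.
  move=> x; apply: cvgB; apply: cvgM; try exact: continuous_gauss_dens; first exact: cdF.
  by apply: cvgM; [exact: cvg_id|exact: cF].
pose H x := gauss_dens x * F x.
have dH (x : R) : is_derive x 1 H (h x).
  have dg := is_derive_gauss_dens x.
  apply: (is_derive_eq (is_deriveM dg (FdF x))).
  by rewrite /h /GRing.scale/=; ring.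
have cH : continuous H.
  by move=> x; apply: differentiable_continuous; apply/derivable1_diffP; case: (dH x).
(* Radius n+1 keeps the interval nondegenerate at n = 0, as [continuous_FTC2] requires. *)
pose I (n : nat) : set R := `[- n.+1%:R, n.+1%:R]%classic.
have ftc n : (\int[mu]_(x in I n) (h x)%:E = (H n.+1%:R - H (- n.+1%:R))%:E)%E.
  apply: (@continuous_FTC2 _ h H).
  - by apply: (@lt_trans _ _ 0); rewrite ?oppr_lt0 ?ltr0n.
  - exact: continuous_subspaceT.
  - split.
    + by move=> x _; case: (dH x).
    + exact/cvg_at_right_filter/cH.
    + exact/cvg_at_left_filter/cH.
  - by move=> x _; rewrite derive1E; case: (dH x).
pose hn (n : nat) := h \_ (I n).
have mh : measurable_fun setT h by exact: continuous_measurable_fun.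
have lim1 : (\int[mu]_x (hn n x)%:E @[n --> \oo] --> \int[mu]_x (h x)%:E)%E.
  apply: (@dominated_cvg _ _ _ mu setT measurableT _ _ (fun x => `|h x|%:E)) => //.
  - move=> n; apply/measurable_EFinP; apply/(measurable_restrictT _ _).1.
      exact: measurable_itv.
    exact: measurable_funTS.
  - move=> x _; apply: cvg_near_cst.
    near=> n; rewrite /hn patchE mem_set// /I /= in_itv/= -ler_norml.
    rewrite (le_trans (ltW (archi_boundP (normr_ge0 x))))// ler_nat.
    by apply: leqW; near: n; exact: nbhs_infty_ge.
  - by have := integrable_abse ih; apply: eq_integrable.
  - move=> n x _; rewrite /hn patchE; case: ifP => _; rewrite lee_fin ?normr_id//.
    by rewrite normr0.
have lim2 : ((H n.+1%:R - H (- n.+1%:R))%:E @[n --> \oo] --> (0 : R)%:E)%E.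
  apply: cvg_EFin; first exact: nearW.
  rewrite -[X in _ --> X](subrr 0).
  have lim0 : K * (expR (a * n.+1%:R) * gauss_dens n.+1%:R) @[n --> \oo] --> (0 : R).
    rewrite -[X in _ --> X](mulr0 K); apply: cvgM; first exact: cvg_cst.
    by have := gauss_exp_cvg0 a; rewrite -cvg_shiftS.
  by apply: cvgB; apply/norm_cvg0P; apply: (squeeze_cvgr _ (cvg_cst 0) lim0);
    apply: nearW => n; rewrite normr_ge0 /H /= normrM mulrC (ger0_norm (ltW (gauss_dens_gt0 _)));
    rewrite ?[gauss_dens (- _)]/gauss_dens ?sqrrN mulrA ler_wpM2r ?(ltW (gauss_dens_gt0 _))//;
    rewrite (le_trans (FK _))// ?normrN ger0_norm.
have e n : (\int[mu]_x (hn n x)%:E = (H n.+1%:R - H (- n.+1%:R))%:E)%E.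
  rewrite -ftc [in RHS]integral_mkcond; apply: eq_integral => x _.
  by rewrite /hn patchE [RHS]patchE; case: ifP.
rewrite /Rintegral (cvg_unique _ lim1 (cvg_trans _ lim2))//.
by apply: near_eq_cvg; apply: nearW => n; rewrite e.
Unshelve. all: by end_near. Qed.


End Gauss.

(** * Solution of Stein's equation *)

Section Stein.
Variable R : realType.
Local Notation mu := (@lebesgue_measure R).
Local Notation gam := (@normal_prob R 0 1).

Lemma gauss_dens_ge0 (x : R) : 0 <= gauss_dens x.
Proof. exact/ltW/gauss_dens_gt0. Qed.

Lemma integrable_gauss_dens : mu.-integrable setT (fun x => (@gauss_dens R x)%:E).
Proof. by rewrite gauss_densE; exact: integrable_normal_pdf. Qed.

Lemma integral_gauss_dens : \int[mu]_x (@gauss_dens R x) = 1.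
Proof. by rewrite /Rintegral gauss_densE integral_normal_pdf. Qed.

Lemma gauss_dens_cvg0 : (@gauss_dens R) x @[x --> +oo%R] --> (0 : R).
Proof.
rewrite /gauss_dens -[X in _ --> X](mul0r (Num.sqrt (pi *+ 2 : R))^-1).
apply: cvgM; last exact: cvg_cst.
rewrite (_ : (fun _ => _) = (fun x : R => expR (- (x ^+ 2 * 2^-1)))); last first.
  by apply/funext => x; rewrite mulNr.
apply: (cvg_comp (fun x => x ^+ 2 * 2^-1) (fun x => expR (- x))); last exact: cvgr_expR.
by apply: gt0_cvgMly; [rewrite invr_gt0|exact: cvgr_expr2].
Qed.

(** On the tail x <= t, and t times the density is minus the derivative of the density, so its
    integral is explicit. *)
Lemma gauss_tail1 (x : R) : 0 <= x -> x * \int[mu]_(t in `[x, +oo[) gauss_dens t <= gauss_dens x.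
Proof.
move=> x0.
have ig : mu.-integrable `[x, +oo[ (fun t => (@gauss_dens R t)%:E).
  by apply: integrableS integrable_gauss_dens => //; exact: measurable_itv.
have cm : {within `[x, +oo[, continuous (fun t : R => t * gauss_dens t)}.
  apply: continuous_subspaceT => t; apply: cvgM; first exact: cvg_id.
  exact: continuous_gauss_dens.
have e : (\int[mu]_(t in `[x, +oo[) (t * gauss_dens t)%:E = (0 - (- gauss_dens x))%:E)%E.
  rewrite EFinB; apply: (@ge0_continuous_FTC2y _ _ (fun t => - gauss_dens t)) => //.
  - by move=> t xt; apply: mulr_ge0; [exact: le_trans xt|exact: gauss_dens_ge0].
  - by rewrite -oppr0; apply: cvgN; exact: gauss_dens_cvg0.
  - by apply: cvgN; apply: cvg_at_right_filter; exact: continuous_gauss_dens.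
  - move=> t _; rewrite derive1E.
    by case: (is_deriveN (is_derive_gauss_dens t)) => _ ->; rewrite mulNr opprK.
rewrite -RintegralZl//.
have -> : gauss_dens x = \int[mu]_(t in `[x, +oo[) (t * gauss_dens t).
  by rewrite /Rintegral e sub0r opprK.
apply: le_Rintegral => //.
- by have /(_ (measurable_itv _)) := fun mD => integrableZl mD x ig; apply: eq_integrable => //; exact: measurable_itv.
- apply/integrableP; split.
    apply/measurable_EFinP; apply: measurable_funTS; apply: measurable_funM => //.
    exact: measurable_gauss_dens.
  rewrite [X in (X < _)%E](_ : _ = (0 - - gauss_dens x)%:E) ?ltry// -e; apply: eq_integral.
  move=> t; rewrite inE/= in_itv/= andbT => xt.
  by rewrite ger0_norm//; apply: mulr_ge0; [exact: le_trans xt|exact: gauss_dens_ge0].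
- move=> t; rewrite /= in_itv/= andbT => xt.
  by rewrite ler_wpM2r// gauss_dens_ge0.
Qed.

(** For x >= 1 this follows from [gauss_tail1]. For x < 1 the tail is at most 1, while the density
    at x is at least the density at 1. *)
Lemma gauss_tail_le (x : R) : 0 <= x ->
  \int[mu]_(t in `[x, +oo[) gauss_dens t <= (1 + (gauss_dens 1)^-1) * gauss_dens x.
Proof.
move=> x0; have g1 := @gauss_dens_gt0 R 1; have gx := gauss_dens_gt0 x.
have ig : mu.-integrable `[x, +oo[ (fun t => (@gauss_dens R t)%:E).
  by apply: integrableS integrable_gauss_dens => //; exact: measurable_itv.
have T0 : 0 <= \int[mu]_(t in `[x, +oo[) (@gauss_dens R t).
  by apply: Rintegral_ge0 => t _; exact: gauss_dens_ge0.
have [x1|x1] := leP 1 x.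
  have h := gauss_tail1 x0; have h1 : 0 <= (gauss_dens 1)^-1 * gauss_dens x.
    by rewrite mulr_ge0 ?invr_ge0 ?ltW.
  rewrite mulrDl mul1r (le_trans (le_trans (ler_peMl T0 x1) h))//.
  by rewrite lerDl.
apply: (@le_trans _ _ 1).
  rewrite -integral_gauss_dens Rintegral_mkcond; apply: le_Rintegral => //.
  - by rewrite -restrict_EFin; apply/integrable_restrict => //; rewrite setTI.
  - exact: integrable_gauss_dens.
  - by move=> t _; rewrite patchE; case: ifP => // _; exact: gauss_dens_ge0.
have h : gauss_dens 1 <= gauss_dens x.
  rewrite /gauss_dens ler_wpM2r ?invr_ge0 ?sqrtr_ge0// ler_expR.
  rewrite ler_pM2r ?invr_gt0// lerN2 expr1n; nra.
rewrite mulrDl mul1r; have : 1 <= (gauss_dens 1)^-1 * gauss_dens x.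
  by rewrite mulrC ler_pdivlMr// mul1r.
by lra.
Qed.

Lemma gauss_tail_opp (x : R) : \int[mu]_(t in `]-oo, x]) (@gauss_dens R t)
  = \int[mu]_(t in `[- x, +oo[) (@gauss_dens R t).
Proof.
rewrite /Rintegral -[in X in fine X = _](opprK x) ge0_integration_by_substitutionNy.
- congr fine; apply: eq_integral => t _.
  by rewrite /= /gauss_dens sqrrN.
- by apply: continuous_subspaceT; exact: continuous_gauss_dens.
- by move=> t _; exact: gauss_dens_ge0.
Qed.

Lemma stein_solution : exists2 C : R, 0 <= C & forall (v : R -> R) (M : R),
  continuous v -> (forall x, `|v x| <= M) ->
  exists f df : R -> R, [/\ forall x : R, is_derive x 1 f (df x), continuous df,
    forall x, `|f x| <= C * M, forall x, `|df x| <= C * M &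
    forall x, df x - x * f x = v x - gaussE v].
Proof.
pose C0 : R := 1 + (gauss_dens 1)^-1.
have C00 : 0 <= C0 by rewrite addr_ge0// invr_ge0 gauss_dens_ge0.
exists (2 * C0 + 4); first by rewrite addr_ge0// mulr_ge0.
move=> v M cv vM.
have M0 : 0 <= M by rewrite (le_trans _ (vM 0)).
have mv : measurable_fun setT v by exact: continuous_measurable_fun.
pose m := gaussE v.
have iv : mu.-integrable setT (fun x => (gauss_dens x * v x)%:E).
  apply/(gauss_integrableP mv); apply: (@gauss_growth_integrable _ _ M 0) => // x.
  by rewrite mul0r expR0 mulr1.
have mM : `|m| <= M.
  rewrite /m /gaussE (le_trans (le_normr_Rintegral _ _))//.
  rewrite -[leRHS]mulr1 -integral_gauss_dens -RintegralZl//; last exact: integrable_gauss_dens.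
  apply: le_Rintegral => //.
  - by have := integrable_abse iv; apply: eq_integrable.
  - by have := integrableZl measurableT M integrable_gauss_dens; apply: eq_integrable.
  - move=> x _; rewrite normrM (ger0_norm (gauss_dens_ge0 _)) mulrC.
    by rewrite ler_wpM2r// gauss_dens_ge0.
pose w x := gauss_dens x * (v x - m).
have iw : mu.-integrable setT (EFin \o w).
  have := integrableB measurableT iv (integrableZl measurableT m integrable_gauss_dens).
  by apply: eq_integrable => // x _; rewrite /w /=; congr (_%:E); ring.
have cw : continuous w.
  move=> x; apply: cvgM; first exact: continuous_gauss_dens.
  by apply: cvgB; [exact: cv|exact: cvg_cst].
have w0 : \int[mu]_x w x = 0.
  transitivity (\int[mu]_x (gauss_dens x * v x - m * gauss_dens x)).
    by apply: eq_Rintegral => x _; rewrite /w; ring.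
  rewrite RintegralB//; last by have := integrableZl measurableT m integrable_gauss_dens; apply: eq_integrable.
  by rewrite RintegralZl ?integral_gauss_dens ?mulr1 ?subrr//; exact: integrable_gauss_dens.
have wle x : `|w x| <= 2 * M * gauss_dens x.
  rewrite /w normrM (ger0_norm (gauss_dens_ge0 _)) mulrC ler_wpM2r ?gauss_dens_ge0//.
  by rewrite (le_trans (ler_normB _ _))// mulr2n mulrDl mul1r lerD.
have Iw (A : set R) : measurable A -> `|\int[mu]_(x in A) w x| <= 2 * M * \int[mu]_(x in A) gauss_dens x.
  move=> mA.
  have iwA : mu.-integrable A (EFin \o w) by exact: integrableS iw.
  have igA : mu.-integrable A (fun x => (@gauss_dens R x)%:E) by exact: integrableS integrable_gauss_dens.
  rewrite (le_trans (le_normr_Rintegral _ _))// -RintegralZl//.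
  apply: le_Rintegral => //.
  - by have := integrable_abse iwA; apply: eq_integrable.
  - by have /(_ mA) := fun mD => integrableZl mD (2 * M) igA; apply: eq_integrable.
pose G x := \int[mu]_(t in `]-oo, x]) w t.
have dG (x : R) : is_derive x 1 G (w x).
  have [|||d e] := @continuous_FTC1 _ w -oo%O x (x + 1) _ _ _ (cw x).
  - by rewrite ltrDl.
  - by apply: integrableS iw => //; exact: measurable_itv.
  - by rewrite ltNyr.
  - by apply: DeriveDef; [exact: d|rewrite -derive1E; exact: e].
(* Since [w] has total integral zero, [G] is also minus an upper tail. The upper tail is bounded for
   x >= 0, the lower one for x <= 0. *)
have GN x : G x = - \int[mu]_(t in `[x, +oo[) w t.
  have iwx : mu.-integrable `]x, +oo[ (EFin \o w).
    by apply: integrableS iw => //; exact: measurable_itv.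
  have := @Rintegral_itvB _ w -oo%O +oo%O x.
  rewrite -/(G x) set_itvNyy w0 sub0r Rintegral_itv_obnd_cbnd//.
  by move=> <-//; rewrite opprK.
have Gpos (x : R) : 0 <= x -> `|G x| <= 2 * M * C0 * gauss_dens x /\ `|x * G x| <= 2 * M * gauss_dens x.
  move=> x0; rewrite normrM (ger0_norm x0) GN normrN; split.
    rewrite (le_trans (Iw _ _))//.
    by rewrite -[leRHS]mulrA ler_wpM2l ?mulr_ge0// gauss_tail_le.
  rewrite (le_trans (ler_wpM2l x0 (Iw _ _)))//.
  by rewrite mulrCA ler_wpM2l ?mulr_ge0// gauss_tail1.
have Gneg (x : R) : x <= 0 -> `|G x| <= 2 * M * C0 * gauss_dens x /\ `|x * G x| <= 2 * M * gauss_dens x.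
  move=> x0; have nx0 : 0 <= - x by rewrite oppr_ge0.
  have gN : gauss_dens (- x) = gauss_dens x by rewrite /gauss_dens sqrrN.
  rewrite normrM -(normrN x) (ger0_norm nx0) -gN; split.
    rewrite (le_trans (Iw _ _))//.
    by rewrite gauss_tail_opp -[leRHS]mulrA ler_wpM2l ?mulr_ge0// gauss_tail_le.
  rewrite (le_trans (ler_wpM2l nx0 (Iw _ _)))//.
  by rewrite gauss_tail_opp mulrCA ler_wpM2l ?mulr_ge0// gauss_tail1.
have Gb (x : R) : `|G x| <= 2 * M * C0 * gauss_dens x /\ `|x * G x| <= 2 * M * gauss_dens x.
  by have [/Gpos|/ltW/Gneg] := leP 0 x.
pose f x := G x / gauss_dens x.
pose df x := x * f x + (v x - m).
have fE x : `|f x| = `|G x| / gauss_dens x.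
  by rewrite normrM normfV (ger0_norm (gauss_dens_ge0 _)).
have df_ (x : R) : is_derive x 1 f (df x).
  have dV : is_derive x 1 (fun y => (@gauss_dens R y)^-1) (x * (gauss_dens x)^-1).
    apply: (is_derive_eq (is_deriveV _ (is_derive_gauss_dens x))).
      by rewrite gt_eqF// gauss_dens_gt0.
    by rewrite /GRing.scale /=; field; rewrite gt_eqF// gauss_dens_gt0.
  have d := is_deriveM (dG x) dV.
  apply: (@is_derive_eq _ _ _ f x 1 _ _ d).
  by rewrite /df /f /w /GRing.scale /=; field; rewrite gt_eqF// gauss_dens_gt0.
have cf : continuous f.
  by move=> x; apply: differentiable_continuous; apply/derivable1_diffP; case: (df_ x).
have xf x : `|x * f x| <= 2 * M.
  rewrite /f mulrA normrM normfV (ger0_norm (gauss_dens_ge0 x)).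
  by rewrite ler_pdivrMr ?gauss_dens_gt0//; case: (Gb x).
exists f, df; split => //.
- move=> x; apply: cvgD; first by apply: cvgM; [exact: cvg_id|exact: cf].
  by apply: cvgB; [exact: cv|exact: cvg_cst].
- move=> x; rewrite (@le_trans _ _ (2 * M * C0))//.
    by rewrite fE ler_pdivrMr ?gauss_dens_gt0//; case: (Gb x).
  by nra.
- move=> x; rewrite /df (le_trans (ler_normD _ _))//.
  have := xf x; have := ler_normB (v x) m; have := vM x.
  have : 0 <= C0 * M by exact: mulr_ge0.
  by lra.
- by move=> x; rewrite /df /m; ring.
Qed.

End Stein.

(** * The disorder as a probability space, and integration by parts *)

Section Fubini.
Context {R : realType} d1 d2 (T1 : measurableType d1) (T2 : measurableType d2)
  (P1 : probability T1 R) (P2 : probability T2 R).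

(** Integrability is assumed on every section, so that [fine] applied to an inner integral discards
    no infinite value at any point. *)
Lemma Rintegral_prod1 (f : T1 * T2 -> R) :
  (P1 \x P2)%E.-integrable setT (EFin \o f) ->
  (forall x, P2.-integrable setT (fun y => (f (x, y))%:E)) ->
  [/\ measurable_fun setT (fun x => \int[P2]_y f (x, y)),
      P1.-integrable setT (fun x => (\int[P2]_y f (x, y))%:E) &
      Rintegral (P1 \x P2)%E setT f = \int[P1]_x \int[P2]_y f (x, y)].
Proof.
move=> intf intfx.
have E x : (\int[P2]_y f (x, y))%:E = fubini_F P2 (EFin \o f) x.
  by rewrite /fubini_F /Rintegral fineK//; exact: integrable_fin_num.
have mf := measurable_fubini_F intf; have i_f := integrable_fubini_F intf.
split.
- by apply/measurable_EFinP; rewrite (_ : _ \o _ = fubini_F P2 (EFin \o f)) //; apply/funext.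
- by rewrite (_ : (fun _ => _) = fubini_F P2 (EFin \o f)) //; apply/funext.
- rewrite /Rintegral -integral12_prod_meas1//; congr fine.
  by apply: eq_integral => x _; rewrite -E.
Qed.

Lemma Rintegral_prod2 (f : T1 * T2 -> R) :
  (P1 \x P2)%E.-integrable setT (EFin \o f) ->
  (forall y, P1.-integrable setT (fun x => (f (x, y))%:E)) ->
  Rintegral (P1 \x P2)%E setT f = \int[P2]_y \int[P1]_x f (x, y).
Proof.
move=> intf intfy.
rewrite /Rintegral -integral21_prod_meas1//; congr fine.
apply: eq_integral => y _.
by rewrite /fubini_G fineK//; exact: integrable_fin_num.
Qed.

End Fubini.

Section Disorder.
Variables (R : realType) (N : nat).
Local Notation gam := (@normal_prob R 0 1).
Local Notation dis := ('I_N -> 'I_N -> R).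
Local Notation idx := ('I_N * 'I_N)%type.

(* Measurability for the sigma-algebra generated by the coordinates, phrased
   through measurable test maps so that no structure on [dis] is needed. *)
Definition dmeas (F : dis -> R) := forall d (T : measurableType d) (X : T -> dis),
  (forall i j, measurable_fun setT (fun t => X t i j)) ->
  measurable_fun setT (fun t => F (X t)).

Definition gnorm (g : dis) : R := \sum_i \sum_j `|g i j|.

(** Exponential growth in the l1 norm is stable under products and under multiplication by a
    coupling. Integrating out one Gaussian coupling also preserves it, because [upd] raises the norm
    by at most |x|. *)
Definition growth (F : dis -> R) := exists K a : R,
  0 <= a /\ forall g, `|F g| <= K * expR (a * gnorm g).

Definition regular (F : dis -> R) := dmeas F /\ growth F.

Lemma gnorm_ge0 g : 0 <= gnorm g.
Proof. by apply: sumr_ge0 => i _; apply: sumr_ge0. Qed.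

Lemma gnorm_coord g i j : `|g i j| <= gnorm g.
Proof.
rewrite /gnorm (bigD1 i)//= (bigD1 j)//= -addrA lerDl addr_ge0//.
  exact: sumr_ge0.
by apply: sumr_ge0 => k _; exact: sumr_ge0.
Qed.

Lemma gnorm_upd g p x : gnorm (upd g p x) <= gnorm g + `|x|.
Proof.
have -> : `|x| = \sum_i \sum_j (if (i == p.1) && (j == p.2) then `|x| else 0).
  rewrite (bigD1 p.1)//= (bigD1 p.2)//= !eqxx/=.
  rewrite big1 => [|j /negPf ->]; last by [].
  rewrite big1 ?addr0// => i /negPf ->.
  by rewrite big1// => j _; rewrite andFb.
rewrite /gnorm -big_split/=; apply: ler_sum => i _.
rewrite -big_split/=; apply: ler_sum => j _.
by rewrite /upd; case: ifP => _; rewrite ?addr0// lerDr.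
Qed.

Lemma expR_gnorm_upd a g p x : 0 <= a ->
  expR (a * gnorm (upd g p x)) <= expR (a * gnorm g) * expR (a * `|x|).
Proof. by move=> a0; rewrite -expRD ler_expR -mulrDr ler_wpM2l// gnorm_upd. Qed.

Definition merge (s : seq idx) (y g : dis) : dis :=
  fun i j => if (i, j) \in s then y i j else g i j.

Lemma merge_cons p s y g x : p \notin s ->
  merge (p :: s) (upd y p x) g = merge s y (upd g p x).
Proof.
move=> ps; apply/funext => i; apply/funext => j.
case: p ps => a b ps; rewrite /merge /upd in_cons xpair_eqE /=.
case: (boolP ((i == a) && (j == b))) => [/andP[/eqP -> /eqP ->]|] /=.
  by rewrite (negPf ps).
by [].
Qed.

Lemma merge_upd p s y g x : p \notin s ->
  merge s y (upd g p x) = upd (merge s y g) p x.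
Proof.
move=> ps; apply/funext => i; apply/funext => j.
rewrite /merge /upd; case: ifP => // ijs; case: ifP => // /andP[/eqP ip /eqP jp].
by move: ps; rewrite (surjective_pairing p) -ip -jp ijs.
Qed.

Lemma measurable_upd d (T : measurableType d) (X : T -> dis) (x : T -> R) p :
  measurable_fun setT x -> (forall i j, measurable_fun setT (fun t => X t i j)) ->
  forall i j, measurable_fun setT (fun t => upd (X t) p (x t) i j).
Proof. by move=> mx mX i j; rewrite /upd; case: ((i == p.1) && (j == p.2)). Qed.

Lemma measurable_merge d (T : measurableType d) (Y X : T -> dis) s :
  (forall i j, measurable_fun setT (fun t => Y t i j)) ->
  (forall i j, measurable_fun setT (fun t => X t i j)) ->
  forall i j, measurable_fun setT (fun t => merge s (Y t) (X t) i j).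
Proof. by move=> mY mX i j; rewrite /merge; case: ((i, j) \in s). Qed.

Lemma dmeas_gnorm : dmeas gnorm.
Proof.
move=> d T X mX; apply: measurable_sum => i; apply: measurable_sum => j.
exact: measurableT_comp.
Qed.

Lemma dmeas_expR_gnorm a : dmeas (fun g => expR (a * gnorm g)).
Proof.
move=> d T X mX; apply: measurableT_comp => //; apply: measurable_funM => //.
exact: dmeas_gnorm.
Qed.

(** Everything that Gaussian integration by parts in the coupling p consumes. Derivative and
    continuity are asked on every line in direction p, because the other couplings are integrated
    afterwards. *)
Record smooth_along (p : idx) (F dF : dis -> R) : Prop := SmoothAlong {
  smooth_reg : regular F;
  smooth_dreg : regular dF;
  smooth_derive : forall g (x : R), is_derive x 1 (fun y => F (upd g p y)) (dF (upd g p x));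
  smooth_cont : forall g, continuous (fun x : R => dF (upd g p x)) }.

Lemma regular_coordM p F : regular F -> regular (fun g => g p.1 p.2 * F g).
Proof.
move=> [mF [K [a [a0 FK]]]]; split.
  by move=> d T X mX; apply: measurable_funM; [exact: mX|exact: mF].
exists K, (a + 1); split; first by rewrite addr_ge0.
move=> g; rewrite mulrDl mul1r expRD mulrA normrM.
rewrite [leLHS]mulrC ler_pM//.
by rewrite (le_trans (gnorm_coord g p.1 p.2))// (le_trans _ (expR_ge1Dx _))// lerDr.
Qed.

Lemma upd_id (g : dis) p x : upd g p x p.1 p.2 = x.
Proof. by rewrite /upd !eqxx. Qed.

Definition exp_moments (s : seq idx) d (T : measurableType d) (P : probability T R) (Y : T -> dis) :=
  (forall i j, measurable_fun setT (fun t => Y t i j)) /\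
  forall a, 0 <= a -> exists C : R, forall g,
    (\int[P]_t (expR (a * gnorm (merge s (Y t) g)))%:E <= (C * expR (a * gnorm g))%:E)%E.

Definition represents (s : seq idx) d (T : measurableType d) (P : probability T R) (Y : T -> dis) :=
  exp_moments s P Y /\ (forall F, regular F -> forall g, gint s F g = \int[P]_t F (merge s (Y t) g)).

Lemma exp_moments_integrable s d (T : measurableType d) (P : probability T R) Y :
  exp_moments s P Y -> forall F, regular F -> forall g,
  P.-integrable setT (fun t => (F (merge s (Y t) g))%:E).
Proof.
move=> [mY eY] F [mF [K [a [a0 FK]]]] g.
have mm : forall i j, measurable_fun setT (fun t => merge s (Y t) g i j) by exact: measurable_merge.
have [C CY] := eY a a0.
apply: (@le_integrable _ _ _ P _ _ _ (fun t => (K * expR (a * gnorm (merge s (Y t) g)))%:E)) => //.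
- by apply/measurable_EFinP; exact: mF.
- by move=> t _; rewrite lee_fin (le_trans (FK _))// ler_norm.
- have i1 : P.-integrable setT (fun t => (expR (a * gnorm (merge s (Y t) g)))%:E).
    apply/integrableP; split; first by apply/measurable_EFinP; exact: dmeas_expR_gnorm.
    under eq_integral do rewrite gee0_abs ?lee_fin ?expR_ge0//.
    by rewrite (le_lt_trans (CY g))// ltry.
  by have := integrableZl measurableT K i1; apply: eq_integrable.
Qed.


Lemma represents_nil : represents [::] (@dirac _ unit tt R : probability unit R) (fun _ _ _ => 0).
Proof.
split=> [|F [mF _] g]; first split=> // a a0.
  by exists 1 => g; rewrite mul1r integral_dirac//= diracE mem_set// mul1e.
have -> : (fun _ : unit => F (merge [::] (fun _ _ => 0) g)) = cst (F g).
  by apply/funext.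
rewrite Rintegral_cst//=.
by rewrite /dirac /= indicT mulr1.
Qed.

Section Cons.
Variables (p : idx) (s : seq idx) (ps : p \notin s).
Variables (d : measure_display) (T : measurableType d) (P : probability T R) (Y : T -> dis).
Hypothesis rep : represents s P Y.
Local Notation TR := (measurableTypeR R).
Local Notation P' := (gam \x P)%E.
Let Y' (z : TR * T) := upd (Y z.2) p z.1.

Let mY' i j : measurable_fun setT (fun t => Y' t i j).
Proof.
apply: measurable_upd; first exact: measurable_fst.
by move=> k l; apply: (measurableT_comp (f := fun t => Y t k l)) => //; case: rep => [[]].
Qed.

Let mergeE z g : merge (p :: s) (Y' z) g = merge s (Y z.2) (upd g p z.1).
Proof. exact: merge_cons. Qed.

Let mmerge g : forall i j, measurable_fun setT (fun z => merge (p :: s) (Y' z) g i j).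
Proof. exact: measurable_merge. Qed.

Let expbound a : 0 <= a -> exists C : R, forall g,
  (\int[P']_z (expR (a * gnorm (merge (p :: s) (Y' z) g)))%:E <= (C * expR (a * gnorm g))%:E)%E.
Proof.
move=> a0; have [[_ /(_ a a0) [C CY]] _] := rep.
have ie := gauss_exp_integrable a.
exists (C * fine (\int[gam]_x (expR (a * `|x|))%:E)) => g.
have C0 : 0 <= C.
  have : (0 <= (C * expR (a * gnorm g))%:E)%E.
    by apply: le_trans (CY g); apply: integral_ge0 => t _; rewrite lee_fin expR_ge0.
  by rewrite lee_fin pmulr_lge0// expR_gt0.
rewrite fubini_tonelli1; last 2 first.
- by apply/measurable_EFinP; exact: dmeas_expR_gnorm.
- by move=> z; rewrite lee_fin expR_ge0.
apply: (@le_trans _ _ (\int[gam]_x ((C * expR (a * gnorm g))%:E * (expR (a * `|x|))%:E))%E).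
  apply: ge0_le_integral => //.
  - by move=> x _; apply: integral_ge0 => t _; rewrite lee_fin expR_ge0.
  - apply: measurable_fun_fubini_tonelli_F.
    + by apply/measurable_EFinP; exact: dmeas_expR_gnorm.
    + by move=> z; rewrite lee_fin expR_ge0.
  - by apply: emeasurable_funM => //; exact: (measurable_int _ ie).
  - move=> x _; rewrite /fubini_F; under eq_integral do rewrite /= mergeE.
    have le1 (y : R) : ((C * expR (a * gnorm (upd g p y)))%:E <=
        (C * expR (a * gnorm g))%:E * (expR (a * `|y|))%:E)%E.
      by rewrite -EFinM lee_fin -mulrA; exact: (ler_wpM2l C0 (expR_gnorm_upd g p y a0)).
    exact: (le_trans (CY (upd g p x)) (le1 x)).
rewrite ge0_integralZl//; last 2 first.
- exact: (measurable_int _ ie).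
- by rewrite lee_fin mulr_ge0// expR_ge0.
rewrite -[X in (_ * X <= _)%E]fineK ?integrable_fin_num//.
by rewrite -EFinM lee_fin mulrAC.
Qed.

Let em' : exp_moments (p :: s) P' Y'. Proof. by split. Qed.

Let integr F g x : regular F -> P.-integrable setT (fun t => (F (merge (p :: s) (Y' (x, t)) g))%:E).
Proof.
move=> rF; under eq_fun do rewrite mergeE /=.
by apply: exp_moments_integrable => //; case: rep.
Qed.

Let gint_cons F g : regular F -> gint (p :: s) F g = \int[P']_z F (merge (p :: s) (Y' z) g).
Proof.
move=> rF; have iF := exp_moments_integrable em' rF g.
have [mI iI ->] := Rintegral_prod1 iF (fun x => integr g x rF).
have E x : gint s F (upd g p x) = \int[P]_t F (merge (p :: s) (Y' (x, t)) g).
  by case: rep => _ ->//; apply: eq_Rintegral => t _; rewrite mergeE.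
rewrite /= (_ : (fun x => _) = (fun x => \int[P]_t F (merge (p :: s) (Y' (x, t)) g))); last exact/funext.
by rewrite gaussE_int.
Qed.

Lemma represents_cons : represents (p :: s) P' Y'.
Proof. by split => // F rF g; exact: gint_cons. Qed.

(** Exchanging the integrals makes the outermost variable of [gint] the inner one; on each line the
    one-variable identity [gauss_ibp] applies. *)
Lemma gint_ibp_head F dF g : smooth_along p F dF ->
  gint (p :: s) (fun g => g p.1 p.2 * F g) g = gint (p :: s) dF g.
Proof.
move=> [rF rdF der cont]; have rpF := regular_coordM p rF.
rewrite !gint_cons//.
have [mF [K [a [a0 FK]]]] := rF; have [mdF [K' [a' [a'0 dFK]]]] := rdF.
have line t x : merge (p :: s) (Y' (x, t)) g = upd (merge s (Y t) g) p x.
  by rewrite mergeE /= merge_upd.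
have grow (H : dis -> R) (t : T) : growth H -> exists KK aa, forall x : R,
    `|H (upd (merge s (Y t) g) p x)| <= KK * expR (aa * `|x|).
  move=> [L [b [b0 HL]]].
  exists (L * expR (b * gnorm (merge s (Y t) g))), b => x.
  have L0 : 0 <= L.
    by have := le_trans (normr_ge0 _) (HL g); rewrite pmulr_lge0// expR_gt0.
  apply: (le_trans (HL _)); rewrite -mulrA; exact: (ler_wpM2l L0 (expR_gnorm_upd _ p x b0)).
have mline (H : dis -> R) t : dmeas H -> measurable_fun setT (fun x : TR => H (upd (merge s (Y t) g) p x)).
  by move=> mH; apply: mH => i j; apply: measurable_upd.
have iline (H : dis -> R) t : regular H -> gam.-integrable setT (fun x : TR => (H (upd (merge s (Y t) g) p x))%:E).
  move=> [mH gH]; have [KK [aa h]] := grow H t gH.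
  by apply: (gauss_growth_integrable _ h); exact: mline.
rewrite !Rintegral_prod2.
- apply: eq_Rintegral => t _.
  have -> : \int[gam]_x dF (merge (p :: s) (Y' (x, t)) g) = gaussE (fun x => dF (upd (merge s (Y t) g) p x)).
    rewrite gaussE_int; [|exact: mline|exact: iline].
    by apply: eq_Rintegral => x _; rewrite line.
  have [K1 [a1 h1]] := grow F t rF.2; have [K2 [a2 h2]] := grow dF t rdF.2.
  (* [gauss_ibp] wants one pair of growth constants for the function and its derivative; sums of
     absolute values dominate both pairs. *)
  have le_KK (L L' b b' x : R) : L * expR (b * `|x|) <= (`|L| + `|L'|) * expR ((`|b| + `|b'|) * `|x|).
    apply: (@le_trans _ _ (`|L| * expR (b * `|x|))); first by rewrite ler_wpM2r ?expR_ge0 ?ler_norm.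
    apply: ler_pM => //; rewrite ?expR_ge0 ?lerDl// ler_expR ler_wpM2r//.
    by rewrite (le_trans (ler_norm _))// lerDl.
  rewrite -(@gauss_ibp R (fun x => F (upd (merge s (Y t) g) p x))
    (fun x => dF (upd (merge s (Y t) g) p x)) (`|K1| + `|K2|) (`|a1| + `|a2|)).
  + rewrite gaussE_int.
    * by apply: eq_Rintegral => x _; rewrite line upd_id.
    * by have := mline _ t rpF.1; apply: eq_measurable_fun => x _; rewrite upd_id.
    * by have := iline _ t rpF; apply: eq_integrable => // x _; rewrite upd_id.
  + exact: cont.
  + by move=> x; rewrite (le_trans (h1 x)).
  + by move=> x; rewrite (le_trans (h2 x))// (addrC `|K1|) (addrC `|a1|).
- exact: exp_moments_integrable.
- by move=> t; under eq_fun do rewrite line; exact: iline.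
- exact: (exp_moments_integrable em' rpF).
- by move=> t; under eq_fun do rewrite line; exact: (iline _ t rpF).
Qed.

End Cons.

Lemma represents_exists s : uniq s -> exists (d : measure_display) (T : measurableType d)
  (P : probability T R) (Y : T -> dis), represents s P Y.
Proof.
elim: s => [_|p s IH /= /andP[ps /IH [d [T [P [Y rep]]]]]].
  by do 4 eexists; exact: represents_nil.
by do 4 eexists; exact: (represents_cons ps rep).
Qed.

(** The coupling p is the head at some depth of the iterated integral; the integrals outside it are
    carried along by congruence. *)
Lemma gint_ibp s p F dF g : uniq s -> p \in s -> smooth_along p F dF ->
  gint s (fun g => g p.1 p.2 * F g) g = gint s dF g.
Proof.
elim: s g => //= q s IH g /andP[qs us]; rewrite in_cons => /orP[/eqP pq|ps] sF.
  have [d [T [P [Y rep]]]] := represents_exists us.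
  by have := gint_ibp_head qs rep g; rewrite -pq; exact.
by congr gaussE; apply/funext => x; exact: IH.
Qed.

Lemma uniq_pairs : uniq (pairs N).
Proof. by rewrite filter_uniq// allpairs_uniq ?enum_uniq// => -[a b] [c e]. Qed.

Lemma mem_pairs p : (p \in pairs N) = (p.1 < p.2)%N.
Proof.
rewrite mem_filter; case: ltnP => //= _; apply/allpairsP; exists p.
by rewrite !mem_enum -surjective_pairing.
Qed.

(** This is how [disE] acquires linearity and monotonicity. The random disorder X later gives the
    cavity field a law. *)
Lemma disE_rep : exists (d : measure_display) (T : measurableType d)
  (P : probability T R) (X : T -> dis), (forall i j, measurable_fun setT (fun t => X t i j)) /\
  forall F, regular F -> P.-integrable setT (fun t => (F (X t))%:E) /\ disE F = \int[P]_t F (X t).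
Proof.
have [d [T [P [Y [em rep]]]]] := represents_exists uniq_pairs.
exists d, T, P, (fun t => merge (pairs N) (Y t) (fun _ _ => 0)); split.
  by apply: measurable_merge => //; case: em.
by move=> F rF; split; [exact: exp_moments_integrable|exact: rep].
Qed.

Lemma disE_ibp (p : idx) F dF : (p.1 < p.2)%N -> smooth_along p F dF ->
  disE (fun g => g p.1 p.2 * F g) = disE dF.
Proof. by move=> pp; apply: gint_ibp; rewrite ?uniq_pairs ?mem_pairs. Qed.

(** * Closure of the regular class; linearity and order for [disE] *)

Lemma growthD F G : growth F -> growth G -> growth (fun g => F g + G g).
Proof.
move=> [K [a [a0 FK]]] [L [b [b0 GL]]]; exists (K + L), (a + b); split; first exact: addr_ge0.
move=> g; rewrite (le_trans (ler_normD _ _))// mulrDl.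
have K0 : 0 <= K by have := le_trans (normr_ge0 _) (FK g); rewrite pmulr_lge0// expR_gt0.
have L0 : 0 <= L by have := le_trans (normr_ge0 _) (GL g); rewrite pmulr_lge0// expR_gt0.
apply: lerD; [apply: (le_trans (FK g))|apply: (le_trans (GL g))]; apply: ler_wpM2l => //;
  rewrite ler_expR ler_wpM2r ?gnorm_ge0//; [by rewrite lerDl|by rewrite lerDr].
Qed.

Lemma growthM F G : growth F -> growth G -> growth (fun g => F g * G g).
Proof.
move=> [K [a [a0 FK]]] [L [b [b0 GL]]]; exists (K * L), (a + b); split; first exact: addr_ge0.
by move=> g; rewrite normrM mulrDl expRD mulrACA; apply: ler_pM.
Qed.

Lemma regularD F G : regular F -> regular G -> regular (fun g => F g + G g).
Proof.
move=> [mF gF] [mG gG]; split; last exact: growthD.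
by move=> d T X mX; apply: measurable_funD; [exact: mF|exact: mG].
Qed.

Lemma regularM F G : regular F -> regular G -> regular (fun g => F g * G g).
Proof.
move=> [mF gF] [mG gG]; split; last exact: growthM.
by move=> d T X mX; apply: measurable_funM; [exact: mF|exact: mG].
Qed.

Lemma regular_bounded F (K : R) : dmeas F -> (forall g, `|F g| <= K) -> regular F.
Proof.
by move=> mF FK; split=> //; exists K, 0; split => // g; rewrite mul0r expR0 mulr1.
Qed.

Lemma regular_cst (c : R) : regular (fun _ => c).
Proof. by apply: (@regular_bounded _ `|c|) => // d T X mX; exact: measurable_cst. Qed.

Lemma regularN F : regular F -> regular (fun g => - F g).
Proof.
move=> rF; have := regularM (regular_cst (-1)) rF.
by under eq_fun do rewrite mulN1r.
Qed.

Lemma regularB F G : regular F -> regular G -> regular (fun g => F g - G g).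
Proof. by move=> rF rG; apply: regularD => //; exact: regularN. Qed.

Lemma regular_sum (I : Type) (r : seq I) (Q : pred I) (F : I -> dis -> R) :
  (forall i, Q i -> regular (F i)) -> regular (fun g => \sum_(i <- r | Q i) F i g).
Proof.
move=> rF; elim: r => [|i r IH].
  by under eq_fun do rewrite big_nil; exact: regular_cst.
under eq_fun do rewrite big_cons; case: (boolP (Q i)) => // Qi.
by apply: regularD => //; exact: rF.
Qed.

Lemma regular_coord i j : regular (fun g => g i j).
Proof.
have := regular_coordM (i, j) (regular_cst 1).
by under eq_fun do rewrite mulr1.
Qed.

Lemma regular_abs F : regular F -> regular (fun g => `|F g|).
Proof.
move=> [mF [K [a [a0 FK]]]]; split; last by exists K, a; split=> // g; rewrite normr_id.
by move=> d T X mX; apply: measurableT_comp => //; exact: mF.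
Qed.

Lemma regularX F n : regular F -> regular (fun g => F g ^+ n).
Proof.
move=> rF; elim: n => [|n IH]; first by under eq_fun do rewrite expr0; exact: regular_cst.
by under eq_fun do rewrite exprS; exact: regularM.
Qed.

Lemma disED F G : regular F -> regular G -> disE (fun g => F g + G g) = disE F + disE G.
Proof.
move=> rF rG; have [d [T [P [X [mX rep]]]]] := disE_rep.
have [iF ->] := rep _ rF; have [iG ->] := rep _ rG; have [_ ->] := rep _ (regularD rF rG).
exact: RintegralD.
Qed.

Lemma disEZ (c : R) F : regular F -> disE (fun g => c * F g) = c * disE F.
Proof.
move=> rF; have [d [T [P [X [mX rep]]]]] := disE_rep.
have [iF ->] := rep _ rF; have [_ ->] := rep _ (regularM (regular_cst c) rF).
exact: RintegralZl.
Qed.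

Lemma disE_cst (c : R) : disE (fun _ : dis => c) = c.
Proof.
have [d [T [P [X [mX rep]]]]] := disE_rep; have [_ ->] := rep _ (regular_cst c).
by rewrite Rintegral_cst// (_ : fine _ = 1) ?mulr1// [X in fine X](@probability_setT _ _ _ P).
Qed.

Lemma disEB F G : regular F -> regular G -> disE (fun g => F g - G g) = disE F - disE G.
Proof.
move=> rF rG; rewrite disED//; last exact: regularN.
congr (_ + _); rewrite -mulN1r -disEZ//; congr disE; apply/funext => g.
by rewrite mulN1r.
Qed.

Lemma disE_sum (I : Type) (r : seq I) (Q : pred I) (F : I -> dis -> R) :
  (forall i, Q i -> regular (F i)) ->
  disE (fun g => \sum_(i <- r | Q i) F i g) = \sum_(i <- r | Q i) disE (F i).
Proof.
move=> rF; elim: r => [|i r IH].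
  rewrite big_nil -[RHS](disE_cst 0); congr disE; apply/funext => g.
  by rewrite big_nil.
rewrite big_cons -IH; have [Qi|Qi] := boolP (Q i).
  rewrite -disED; [|exact: rF|exact: regular_sum].
  by congr disE; apply/funext => g; rewrite big_cons Qi.
by congr disE; apply/funext => g; rewrite big_cons (negPf Qi).
Qed.

Lemma disE_le F G : regular F -> regular G -> (forall g, F g <= G g) -> disE F <= disE G.
Proof.
move=> rF rG FG; have [d [T [P [X [mX rep]]]]] := disE_rep.
have [iF ->] := rep _ rF; have [iG ->] := rep _ rG.
by apply: le_Rintegral => // t _; exact: FG.
Qed.

Lemma disE_norm_le F G : regular F -> regular G -> (forall g, `|F g| <= G g) -> `|disE F| <= disE G.
Proof.
move=> rF rG FG; rewrite ler_norml -(opprK (disE F)) lerN2 opprK -mulN1r -disEZ//.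
by apply/andP; split; apply: disE_le => //; first exact: (regularM (regular_cst _) rF);
  move=> g; have := FG g; rewrite ler_norml => /andP[]; rewrite ?mulN1r// lerNl.
Qed.

(** * Differentiation rules along one coupling *)

Lemma smooth_continuous p F dF g : smooth_along p F dF -> continuous (fun x : R => F (upd g p x)).
Proof.
move=> sF x; apply: differentiable_continuous; apply/derivable1_diffP.
by case: (smooth_derive sF g x).
Qed.

Lemma smooth_cst p (c : R) : smooth_along p (fun _ => c) (fun _ => 0).
Proof.
split; try exact: regular_cst; first by move=> g x; exact: is_derive_cst.
by move=> g x; exact: cvg_cst.
Qed.

Lemma smooth_along_eq p F G dF dG : smooth_along p F dF -> F =1 G -> dF =1 dG -> smooth_along p G dG.
Proof. by move=> + /funext FG /funext dFG; rewrite FG dFG. Qed.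

Lemma smoothD p F G dF dG : smooth_along p F dF -> smooth_along p G dG ->
  smooth_along p (fun g => F g + G g) (fun g => dF g + dG g).
Proof.
move=> sF sG; split.
- exact: regularD (smooth_reg sF) (smooth_reg sG).
- exact: regularD (smooth_dreg sF) (smooth_dreg sG).
- by move=> g x; exact: is_deriveD (smooth_derive sF g x) (smooth_derive sG g x).
- by move=> g x; apply: cvgD; [exact: smooth_cont sF g x|exact: smooth_cont sG g x].
Qed.

Lemma smoothM p F G dF dG : smooth_along p F dF -> smooth_along p G dG ->
  smooth_along p (fun g => F g * G g) (fun g => dF g * G g + F g * dG g).
Proof.
move=> sF sG; have [rF rdF _ _] := sF; have [rG rdG _ _] := sG; split.
- exact: regularM.
- by apply: regularD; exact: regularM.
- move=> g x; apply: (is_derive_eq (is_deriveM (smooth_derive sF g x) (smooth_derive sG g x))).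
  by rewrite /GRing.scale/=; ring.
- move=> g x; apply: cvgD; apply: cvgM.
  + exact: smooth_cont sF g x.
  + exact: (smooth_continuous sG).
  + exact: (smooth_continuous sF).
  + exact: smooth_cont sG g x.
Qed.

Lemma smoothZ p (c : R) F dF : smooth_along p F dF ->
  smooth_along p (fun g => c * F g) (fun g => c * dF g).
Proof.
move=> sF; apply: (smooth_along_eq (smoothM (smooth_cst p c) sF)) => // g.
by rewrite mul0r add0r.
Qed.

Lemma smoothB p F G dF dG : smooth_along p F dF -> smooth_along p G dG ->
  smooth_along p (fun g => F g - G g) (fun g => dF g - dG g).
Proof.
move=> sF sG; apply: (smooth_along_eq (smoothD sF (smoothZ (-1) sG))) => g;
  by rewrite mulN1r.
Qed.

Lemma smooth_sum p (I : Type) (r : seq I) (Q : pred I) (F dF : I -> dis -> R) :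
  (forall i, Q i -> smooth_along p (F i) (dF i)) ->
  smooth_along p (fun g => \sum_(i <- r | Q i) F i g) (fun g => \sum_(i <- r | Q i) dF i g).
Proof.
move=> sF; elim: r => [|i r IH].
  by apply: (smooth_along_eq (smooth_cst p 0)) => g; rewrite big_nil.
have [Qi|Qi] := boolP (Q i).
  by apply: (smooth_along_eq (smoothD (sF i Qi) IH)) => g; rewrite big_cons Qi.
by apply: (smooth_along_eq IH) => g; rewrite big_cons (negPf Qi).
Qed.

Lemma smooth_coord p i j :
  smooth_along p (fun g => g i j) (fun _ => if (i == p.1) && (j == p.2) then 1 else 0).
Proof.
split; [exact: regular_coord|exact: regular_cst| |by move=> g x; exact: cvg_cst].
by move=> g x; rewrite /upd; case: ifP => _; [exact: is_derive_id|exact: is_derive_cst].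
Qed.

Lemma smooth_comp p F dF (f df : R -> R) (K : R) : smooth_along p F dF ->
  (forall x : R, is_derive x 1 f (df x)) -> continuous df ->
  (forall x, `|f x| <= K) -> (forall x, `|df x| <= K) ->
  smooth_along p (fun g => f (F g)) (fun g => df (F g) * dF g).
Proof.
move=> sF fdf cdf fK dfK; have [rF rdF _ _] := sF.
have cf : continuous f.
  by move=> x; apply: differentiable_continuous; apply/derivable1_diffP; case: (fdf x).
have rcomp (h : R -> R) : continuous h -> (forall x, `|h x| <= K) -> regular (fun g => h (F g)).
  move=> ch hK; apply: (@regular_bounded _ K) => // d T X mX.
  by apply: measurableT_comp; [exact: continuous_measurable_fun|exact: rF.1].
split.
- exact: rcomp.
- by apply: regularM => //; exact: rcomp.
- move=> g x.
  exact: (@is_derive1_comp _ f (fun y => F (upd g p y)) x _ _ (fdf _) (smooth_derive sF g x)).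
- move=> g x; apply: cvgM; last exact: smooth_cont sF g x.
  apply: (@continuous_comp _ _ _ (fun y => F (upd g p y)) df); last exact: cdf.
  exact: (smooth_continuous sF).
Qed.

End Disorder.

(** * Replica algebra for a fixed Gibbs weight *)

Section Weights.
Variables (R : realType) (N : nat).
Local Notation conf := {ffun 'I_N -> bool}.
Variable w : conf -> R.
Hypotheses (w_ge0 : forall s, 0 <= w s) (w_sum : \sum_s w s = 1).
Implicit Types A B l : conf -> R.

Definition wE A : R := \sum_s w s * A s.
Definition wE2 (f : conf -> conf -> R) : R := \sum_s1 \sum_s2 w s1 * w s2 * f s1 s2.

Definition sp (k : 'I_N) : conf -> R := fun s => spin R s k.
Definition one : conf -> R := fun _ => 1.

Lemma spK (k : 'I_N) s : sp k s * sp k s = 1.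
Proof. by rewrite /sp /spin; case: (s k); rewrite ?mulr1// mulrNN mulr1. Qed.

Lemma sp_norm k s : `|sp k s| = 1.
Proof. by rewrite /sp /spin; case: (s k); rewrite ?normrN normr1. Qed.

Lemma wE_ext A B : A =1 B -> wE A = wE B.
Proof. by move=> AB; apply: eq_bigr => s _; rewrite AB. Qed.

Lemma wE_le A B : (forall s, A s <= B s) -> wE A <= wE B.
Proof. by move=> AB; apply: ler_sum => s _; rewrite ler_wpM2l. Qed.

Lemma wED A B : wE (fun s => A s + B s) = wE A + wE B.
Proof. by rewrite -big_split; apply: eq_bigr => s _; rewrite mulrDr. Qed.

Lemma wEZ c A : wE (fun s => c * A s) = c * wE A.
Proof. by rewrite mulr_sumr; apply: eq_bigr => s _; rewrite mulrCA. Qed.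

Lemma wE_cst c : wE (fun _ => c) = c.
Proof. by rewrite /wE -mulr_suml w_sum mul1r. Qed.

Lemma wE_norm A : `|wE A| <= wE (fun s => `|A s|).
Proof.
rewrite (le_trans (ler_norm_sum _ _ _))//; apply: ler_sum => s _.
by rewrite normrM (ger0_norm (w_ge0 s)).
Qed.

Lemma wE_norm_le1 A : (forall s, `|A s| <= 1) -> `|wE A| <= 1.
Proof. by move=> A1; rewrite (le_trans (wE_norm A))// -[leRHS]wE_cst; exact: wE_le. Qed.

Lemma wE_sqr A : wE A ^+ 2 <= wE (fun s => A s ^+ 2).
Proof.
have : 0 <= wE (fun s => (A s - wE A) ^+ 2).
  by apply: sumr_ge0 => s _; rewrite mulr_ge0// sqr_ge0.
have -> : wE (fun s => (A s - wE A) ^+ 2) =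
    wE (fun s => A s ^+ 2 + (- 2 * wE A * A s + wE A ^+ 2)).
  by apply: wE_ext => s; ring.
by rewrite !wED wEZ wE_cst expr2; lra.
Qed.

Lemma wE2_le (f g : conf -> conf -> R) : (forall s t, f s t <= g s t) -> wE2 f <= wE2 g.
Proof.
by move=> fg; apply: ler_sum => s _; apply: ler_sum => t _; rewrite ler_wpM2l// mulr_ge0.
Qed.

Lemma wE2_norm (f : conf -> conf -> R) : `|wE2 f| <= wE2 (fun s t => `|f s t|).
Proof.
rewrite (le_trans (ler_norm_sum _ _ _))//; apply: ler_sum => s _.
rewrite (le_trans (ler_norm_sum _ _ _))//; apply: ler_sum => t _.
by rewrite normrM (ger0_norm (mulr_ge0 (w_ge0 s) (w_ge0 t))).
Qed.

Lemma wE2_prod A B : wE2 (fun s t => A s * B t) = wE A * wE B.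
Proof.
rewrite /wE2 /wE big_distrlr/=; apply: eq_bigr => s _; apply: eq_bigr => t _.
by rewrite mulrACA.
Qed.

Lemma wE2D f g : wE2 (fun s t => f s t + g s t) = wE2 f + wE2 g.
Proof.
rewrite -big_split; apply: eq_bigr => s _; rewrite -big_split; apply: eq_bigr => t _.
by rewrite mulrDr.
Qed.

Lemma wE2Z c f : wE2 (fun s t => c * f s t) = c * wE2 f.
Proof.
rewrite mulr_sumr; apply: eq_bigr => s _; rewrite mulr_sumr; apply: eq_bigr => t _.
by rewrite mulrCA.
Qed.

Lemma wE2_ext f g : f =2 g -> wE2 f = wE2 g.
Proof. by move=> fg; apply: eq_bigr => s _; apply: eq_bigr => t _; rewrite fg. Qed.

Variable q : R.
Definition rho A B : R := wE2 (fun s t => A s * B t * (overlap R s t - q)).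
Definition rr : R := wE2 (fun s t => (overlap R s t - q) ^+ 2).

Lemma rr_ge0 : 0 <= rr.
Proof.
by apply: sumr_ge0 => s _; apply: sumr_ge0 => t _; apply: mulr_ge0; [exact: mulr_ge0|exact: sqr_ge0].
Qed.

(* AM-GM inside the replica average *)
Lemma rho_bound (dl y : R) A B l : 0 < dl -> (forall s, `|A s| <= 1) ->
  (forall s, `|y * B s| <= `|l s|) ->
  `|y * rho A B| <= dl * wE (fun s => l s ^+ 2) + rr / (4 * dl).
Proof.
move=> dl0 A1 Bl; rewrite -wE2Z (le_trans (wE2_norm _))//.
have -> : dl * wE (fun s => l s ^+ 2) + rr / (4 * dl) =
    wE2 (fun s t => dl * (one s * l t ^+ 2) + (4 * dl)^-1 * (overlap R s t - q) ^+ 2).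
  by rewrite wE2D (wE2Z dl) (wE2Z (4 * dl)^-1) (wE2_prod one (fun t => l t ^+ 2)) wE_cst mul1r [_ / _]mulrC.
apply: wE2_le => s t; rewrite /one mul1r.
set x := overlap R s t - q.
have -> : y * (A s * B t * x) = A s * (y * B t) * x by ring.
rewrite normrM [`|_ * (_ * _)|]normrM.
have h1 : `|A s| * `|y * B t| * `|x| <= `|l t| * `|x|.
  rewrite ler_wpM2r//; have := Bl t; have := A1 s.
  have := normr_ge0 (A s); have := normr_ge0 (y * B t).
  move: (`|A s|) (`|y * B t|) (`|l t|) => a c e; nra.
rewrite (le_trans h1)// -subr_ge0 -(real_normK (num_real x)) -(real_normK (num_real (l t))).
have -> : dl * `|l t| ^+ 2 + (4 * dl)^-1 * `|x| ^+ 2 - `|l t| * `|x| =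
  dl * (`|l t| - `|x| / (2 * dl)) ^+ 2 by field; rewrite gt_eqF.
by rewrite mulr_ge0 ?sqr_ge0// ltW.
Qed.

Hypothesis N0 : (0 < N)%N.

(** Summing over sites turns products of one-replica averages into a two-replica average containing
    N R_12. Splitting R_12 into q and its deviation separates the limiting value from the error
    [rho]. *)
Lemma sum_spin A B :
  \sum_k wE (A \* sp k) * wE (B \* sp k) = N%:R * (q * wE A * wE B + rho A B).
Proof.
have n0 : N%:R != 0 :> R by rewrite pnatr_eq0 -lt0n.
have -> : q * wE A * wE B + rho A B = wE2 (fun s t => A s * B t * overlap R s t).
  rewrite -mulrA -wE2_prod -wE2Z -wE2D; apply: wE2_ext => s t.
  by ring.
under eq_bigr do rewrite -wE2_prod.
rewrite /wE2 exchange_big mulr_sumr; apply: eq_bigr => s _ /=.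
rewrite exchange_big mulr_sumr; apply: eq_bigr => t _ /=.
rewrite -mulr_sumr mulrCA; congr (_ * _).
rewrite /overlap [RHS]mulrC !mulrA mulfVK// mulr_sumr.
by apply: eq_bigr => k _; rewrite /sp; ring.
Qed.

Variable i : 'I_N.
Local Notation si := (sp i).
Local Notation c := (wE si).

(** Gibbs covariance of A with the bond s_i s_k: up to the factor beta / sqrt N, the response of <A>
    to the coupling of i and k. *)
Definition Mk k A : R := wE (A \* si \* sp k) - wE A * wE (si \* sp k).
Definition mk k : R := wE (si \* sp k) - c * wE (sp k).

Lemma wE_sii A : wE (A \* si \* si) = wE A.
Proof. by apply: wE_ext => s /=; rewrite -mulrA spK mulr1. Qed.

Lemma wE_ii : wE (si \* si) = 1.
Proof. by rewrite -[RHS]wE_cst; apply: wE_ext => s /=; rewrite spK. Qed.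

(** The bond of i with itself is the constant 1, so its covariances vanish; the excluded site can be
    put back into sums of [Mk] for free. *)
Lemma Mk_i A : Mk i A = 0.
Proof. by rewrite /Mk wE_sii wE_ii mulr1 subrr. Qed.

Lemma wE_one k : wE (sp k) = wE (one \* sp k).
Proof. by apply: wE_ext => s /=; rewrite mul1r. Qed.

Lemma wE_oneE : wE one = 1. Proof. exact: wE_cst. Qed.

Lemma sum_Mk (f : 'I_N -> R) A : \sum_(k | k != i) f k * Mk k A = \sum_k f k * Mk k A.
Proof. by rewrite [RHS](bigD1 i)//= Mk_i mulr0 add0r. Qed.

Lemma sum_sp_Mk A : \sum_(k | k != i) wE (sp k) * Mk k A =
  N%:R * (q * (wE (A \* si) - wE A * c) + rho one (A \* si) - wE A * rho one si).
Proof.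
rewrite sum_Mk (eq_bigr (fun k => wE (one \* sp k) * wE (A \* si \* sp k) -
    wE A * (wE (one \* sp k) * wE (si \* sp k)))); last first.
  by move=> k _; rewrite /Mk (wE_one k); ring.
rewrite big_split sumrN -mulr_sumr/= !sum_spin wE_oneE; ring.
Qed.

(** [mk k] averages s_k against s_i - c, which has Gibbs mean zero, so the q part of [sum_spin]
    drops out and only deviations remain. *)
Lemma sum_mk_Mk A : \sum_(k | k != i) mk k * Mk k A =
  N%:R * (rho si (A \* si) - wE A * rho si si - c * rho one (A \* si) + c * wE A * rho one si).
Proof.
rewrite sum_Mk (eq_bigr (fun k => wE (si \* sp k) * wE (A \* si \* sp k) -
    wE A * (wE (si \* sp k) * wE (si \* sp k)) - c * (wE (one \* sp k) * wE (A \* si \* sp k))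
    + c * wE A * (wE (one \* sp k) * wE (si \* sp k)))); last first.
  by move=> k _; rewrite /Mk /mk (wE_one k); ring.
by rewrite !big_split !sumrN -!mulr_sumr/= !sum_spin wE_oneE; ring.
Qed.

(** Completing the sum adds the square (1 - c^2)^2 at site i; hence an inequality. *)
Lemma sum_mk_sqr : \sum_(k | k != i) mk k ^+ 2 <=
  N%:R * (rho si si - 2 * c * rho one si + c ^+ 2 * rho one one).
Proof.
apply: (@le_trans _ _ (\sum_k mk k ^+ 2)).
  by rewrite [leRHS](bigD1 i)//= lerDr sqr_ge0.
rewrite (eq_bigr (fun k => wE (si \* sp k) * wE (si \* sp k) -
    2 * c * (wE (one \* sp k) * wE (si \* sp k)) + c ^+ 2 * (wE (one \* sp k) * wE (one \* sp k)))); last first.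
  by move=> k _; rewrite /mk (wE_one k); ring.
rewrite !big_split !sumrN -!mulr_sumr/= !sum_spin wE_oneE.
by rewrite le_eqVlt; apply/orP; left; apply/eqP; ring.
Qed.

Lemma Mk_sp k : Mk k (sp k) = c - wE (sp k) * wE (si \* sp k).
Proof.
rewrite /Mk; congr (_ - _); apply: wE_ext => s /=.
by rewrite mulrAC spK mul1r.
Qed.

Lemma sum_Mk_sp : \sum_(k | k != i) Mk k (sp k) = N%:R * ((1 - q) * c - rho one si).
Proof.
transitivity (\sum_k Mk k (sp k)); first by rewrite [RHS](bigD1 i)//= Mk_i add0r.
rewrite (eq_bigr (fun k => c - wE (one \* sp k) * wE (si \* sp k))); last first.
  by move=> k _; rewrite Mk_sp (wE_one k).
rewrite big_split sumrN /= sum_spin sumr_const card_ord wE_oneE -mulr_natl; ring.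
Qed.

(* The derivative of [mk k] in the coupling of [i] and [k], without the
   factor beta / sqrt N. *)
Definition dmk k : R := Mk k (si \* sp k) - (Mk k si * wE (sp k) + c * Mk k (sp k)).

(** The leading term (1 - q)(1 - c^2), multiplied by beta, is the quantity subtracted in [Vi]: the
    linear-response value originates here. *)
Lemma sum_dmk : \sum_(k | k != i) dmk k =
  N%:R * ((1 - q) * (1 - c ^+ 2) - rho si si + 2 * c * rho one si - rho one one).
Proof.
transitivity (\sum_k dmk k).
  by rewrite [RHS](bigD1 i)//= /dmk !Mk_i mul0r mulr0 addr0 subr0 add0r.
rewrite (eq_bigr (fun k => 1 - c ^+ 2 - wE (si \* sp k) * wE (si \* sp k) +
    2 * c * (wE (one \* sp k) * wE (si \* sp k)) - wE (one \* sp k) * wE (one \* sp k))); last first.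
  move=> k _; rewrite /dmk Mk_sp -!(wE_one k) /Mk.
  have -> : wE ((si \* sp k) \* si \* sp k) = 1.
    rewrite -[RHS]wE_cst; apply: wE_ext => s /=.
    by rewrite -mulrA mulrACA !spK mulr1.
  have -> : wE (si \* si \* sp k) = wE (sp k).
    by apply: wE_ext => s /=; rewrite spK mul1r.
  by ring.
rewrite !big_split !sumrN -!mulr_sumr/= !sum_spin !sumr_const card_ord wE_oneE.
by rewrite -[c *+ N]mulr_natl; ring.
Qed.

(** The missing site contributes c^2, which after division by N becomes the 1/N term of [DcavE]. *)
Lemma sum_sp_sqr : \sum_(k | k != i) wE (sp k) * wE (sp k) =
  N%:R * (q + rho one one) - c ^+ 2.
Proof.
have : \sum_k wE (sp k) * wE (sp k) = N%:R * (q + rho one one).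
  rewrite (eq_bigr (fun k => wE (one \* sp k) * wE (one \* sp k))); last first.
    by move=> k _; rewrite (wE_one k).
  by rewrite sum_spin wE_oneE !mulr1.
by rewrite (bigD1 i)//= => <-; ring.
Qed.

End Weights.

(** * Smoothness of Gibbs averages *)

Section GibbsSmooth.
Variables (R : realType) (N : nat) (beta h : R).
Local Notation conf := {ffun 'I_N -> bool}.
Local Notation dis := ('I_N -> 'I_N -> R).
Local Notation idx := ('I_N * 'I_N)%type.
Local Notation b0 := (beta / Num.sqrt N%:R).
Local Notation gb := (fun g : dis => gibbs beta h g).

Lemma Zpart_gt0 (g : dis) : 0 < Zpart beta h g.
Proof.
rewrite /Zpart (bigD1 [ffun _ => true])//= ltr_pwDl ?expR_gt0//.
by apply: sumr_ge0 => s _; exact: expR_ge0.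
Qed.

Lemma gibbs_ge0 (g : dis) s : 0 <= gibbs beta h g s.
Proof. by rewrite /gibbs divr_ge0 ?expR_ge0// ltW// Zpart_gt0. Qed.

Lemma gibbs_sum (g : dis) : \sum_s gibbs beta h g s = 1.
Proof. by rewrite /gibbs -mulr_suml divff// gt_eqF// Zpart_gt0. Qed.

Lemma gibbs_le1 (g : dis) s : gibbs beta h g s <= 1.
Proof.
rewrite -(gibbs_sum g) (bigD1 s)//= lerDl; apply: sumr_ge0 => t _; exact: gibbs_ge0.
Qed.

Definition bond (p : idx) (s : conf) : R := spin R s p.1 * spin R s p.2.

Lemma smooth_hamil (p : idx) (s : conf) : (p.1 < p.2)%N ->
  smooth_along p (fun g => hamil beta h g s) (fun _ => b0 * bond p s).
Proof.
move=> pp.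
have s1 : smooth_along p (fun g : dis => \sum_(i < N) \sum_(j < N | (i < j)%N) (spin R s i * spin R s j) * g i j)
    (fun _ => \sum_(i < N) \sum_(j < N | (i < j)%N)
       (spin R s i * spin R s j) * (if (i == p.1) && (j == p.2) then 1 else 0)).
  apply: smooth_sum => i _; apply: smooth_sum => j _; apply: smoothZ; exact: smooth_coord.
apply: (smooth_along_eq (smoothD (smoothZ b0 s1) (smooth_cst p (h * \sum_(i < N) spin R s i)))) => g.
  rewrite /hamil; congr (_ * _ + _); apply: eq_bigr => i _; apply: eq_bigr => j _.
  by rewrite mulrC mulrA.
rewrite addr0; congr (_ * _).
rewrite (bigD1 p.1)//= (bigD1 p.2)//= !eqxx/= mulr1 big1; last first.
  by move=> j /andP[_ /negPf ->]; rewrite mulr0.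
rewrite big1 ?addr0// => i /negPf ip.
by apply: big1 => j _; rewrite ip mulr0.
Qed.

Lemma dmeas_expR_hamil s : dmeas (fun g : dis => expR (hamil beta h g s)).
Proof.
move=> d T X mX; apply: measurableT_comp => //.
apply: measurable_funD => //; apply: measurable_funM => //.
apply: measurable_sum => i.
under eq_fun do rewrite big_mkcond/=; apply: measurable_sum => j.
case: (i < j)%N; last exact: measurable_cst.
by apply: measurable_funM => //; apply: measurable_funM => //; exact: mX.
Qed.

Lemma dmeas_gibbs s : dmeas (fun g : dis => gibbs beta h g s).
Proof.
move=> d T X mX.
(* Division by the positive Z is written as multiplication by exp(- ln Z), reducing measurability to
   that of [expR] and [ln]. *)
have -> : (fun t => gibbs beta h (X t) s) =
    (fun t => expR (hamil beta h (X t) s) * expR (- ln (Zpart beta h (X t)))).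
  by apply/funext => t; rewrite expRN lnK// posrE Zpart_gt0.
apply: measurable_funM; first exact: dmeas_expR_hamil.
apply: measurableT_comp => //; apply: measurableT_comp => //.
apply: measurableT_comp; first exact: measurable_ln.
by apply: measurable_sum => t; exact: dmeas_expR_hamil.
Qed.

Lemma regular_gibbs s : regular (fun g : dis => gibbs beta h g s).
Proof.
apply: (@regular_bounded _ _ _ 1); first exact: dmeas_gibbs.
by move=> g; rewrite ger0_norm ?gibbs_ge0// gibbs_le1.
Qed.

(** The logarithmic derivative of a Gibbs weight is the bond minus its Gibbs mean, times beta / sqrt
    N. *)
Lemma smooth_gibbs (p : idx) (s : conf) : (p.1 < p.2)%N ->
  smooth_along p (fun g => gibbs beta h g s)
    (fun g => b0 * (gibbs beta h g s * (bond p s - wE (gibbs beta h g) (bond p)))).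
Proof.
move=> pp.
have der t (g : dis) (x : R) : is_derive x 1 (fun y => gibbs beta h (upd g p y) t)
    (b0 * (gibbs beta h (upd g p x) t * (bond p t - wE (gibbs beta h (upd g p x)) (bond p)))).
  have de u : is_derive x 1 (fun y => expR (hamil beta h (upd g p y) u))
      (expR (hamil beta h (upd g p x) u) * (b0 * bond p u)).
    exact: (@is_derive1_comp _ expR (fun y => hamil beta h (upd g p y) u) _ _ _ _
      (smooth_derive (smooth_hamil u pp) g x)).
  have dZ : is_derive x 1 (fun y => Zpart beta h (upd g p y))
      (\sum_u expR (hamil beta h (upd g p x) u) * (b0 * bond p u)).
    rewrite /Zpart; move: (index_enum _) => r; elim: r => [|u r IH].
      by under eq_fun do rewrite big_nil; rewrite big_nil; exact: is_derive_cst.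
    by under eq_fun do rewrite big_cons; rewrite big_cons; exact: is_deriveD.
  have Zn0 : Zpart beta h (upd g p x) != 0 by rewrite gt_eqF// Zpart_gt0.
  have d1 := is_deriveM (de t) (is_deriveV Zn0 dZ).
  apply: (is_derive_eq d1); rewrite /GRing.scale/= /wE /gibbs.
  rewrite [X in _ - X](_ : _ = (Zpart beta h (upd g p x))^-1 *
    \sum_u expR (hamil beta h (upd g p x) u) * bond p u); last first.
    by rewrite mulr_sumr; apply: eq_bigr => u _; ring.
  rewrite [X in - _ ^- 2 * X](_ : _ = b0 *
    \sum_u expR (hamil beta h (upd g p x) u) * bond p u); last first.
    by rewrite mulr_sumr; apply: eq_bigr => u _; ring.
  by move: (b0) => b'; field.
have cont t (g : dis) : continuous (fun x : R => gibbs beta h (upd g p x) t).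
  by move=> x; apply: differentiable_continuous; apply/derivable1_diffP; case: (der t g x).
split => //.
- exact: regular_gibbs.
- apply: regularM; first exact: regular_cst.
  apply: regularM; first exact: regular_gibbs.
  apply: regularB; first exact: regular_cst.
  by apply: regular_sum => t _; apply: regularM; [exact: regular_gibbs|exact: regular_cst].
- move=> g x; apply: cvgM; first exact: cvg_cst.
  apply: cvgM; first exact: cont.
  apply: cvgB; first exact: cvg_cst.
  rewrite /wE; move: (index_enum _) => r; elim: r => [|t r IH].
    by under eq_cvg do rewrite big_nil; rewrite big_nil; exact: cvg_cst.
  under eq_cvg do rewrite big_cons; rewrite big_cons; apply: cvgD IH.
  by apply: cvgM; [exact: cont|exact: cvg_cst].
Qed.

(** There are two sources of dependence: A itself may involve g, and the weights contribute a Gibbs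
    covariance with the bond. *)
Lemma smooth_wE (p : idx) (A dA : conf -> dis -> R) : (p.1 < p.2)%N ->
  (forall s, smooth_along p (A s) (dA s)) ->
  smooth_along p (fun g => wE (gibbs beta h g) (A ^~ g))
    (fun g => wE (gibbs beta h g) (dA ^~ g) +
      b0 * (wE (gibbs beta h g) (fun s => A s g * bond p s) -
            wE (gibbs beta h g) (A ^~ g) * wE (gibbs beta h g) (bond p))).
Proof.
move=> pp sA.
have := @smooth_sum _ _ p _ (index_enum conf) predT _ _ (fun s _ => smoothM (smooth_gibbs s pp) (sA s)).
move/smooth_along_eq; apply => // g.
rewrite {1}/wE [X in b0 * (X - _)]/wE [X in _ - X * _]/wE mulr_suml.
rewrite -sumrB mulr_sumr -big_split; apply: eq_bigr => s _ /=.
by rewrite /wE; ring.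
Qed.

Lemma regular_wE (A : conf -> dis -> R) : (forall s, regular (A s)) ->
  regular (fun g => wE (gibbs beta h g) (A ^~ g)).
Proof. by move=> rA; apply: regular_sum => s _; apply: regularM; [exact: regular_gibbs|]. Qed.

End GibbsSmooth.

(** * Cavity computation *)

(** Merging the sums lets an identity between them be checked summand by summand with [ring]. *)
Lemma sum_lin5 (R : pzRingType) (I : finType) (Q : pred I) (a1 a2 a3 a4 a5 : R)
  (f1 f2 f3 f4 f5 : I -> R) :
  a1 * (\sum_(k | Q k) f1 k) + a2 * (\sum_(k | Q k) f2 k) + a3 * (\sum_(k | Q k) f3 k)
  + a4 * (\sum_(k | Q k) f4 k) + a5 * (\sum_(k | Q k) f5 k) =
  \sum_(k | Q k) (a1 * f1 k + a2 * f2 k + a3 * f3 k + a4 * f4 k + a5 * f5 k).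
Proof. by rewrite !mulr_sumr -!big_split. Qed.

Lemma sum_lin3 (R : pzRingType) (I : finType) (Q : pred I) (a1 a2 a3 : R) (f1 f2 f3 : I -> R) :
  a1 * (\sum_(k | Q k) f1 k) + a2 * (\sum_(k | Q k) f2 k) + a3 * (\sum_(k | Q k) f3 k) =
  \sum_(k | Q k) (a1 * f1 k + a2 * f2 k + a3 * f3 k).
Proof. by rewrite !mulr_sumr -!big_split. Qed.

Section Cavity.
Variables (R : realType) (N : nat) (beta h q : R) (i : 'I_N).
Hypotheses (beta_gt0 : 0 < beta) (q01 : 0 < q < 1).
Local Notation conf := {ffun 'I_N -> bool}.
Local Notation dis := ('I_N -> 'I_N -> R).
Local Notation idx := ('I_N * 'I_N)%type.
Local Notation sN := (Num.sqrt N%:R : R).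
Local Notation b0 := (beta / sN).
Local Notation w := (gibbs beta h).
Local Notation si := (sp R i).
Local Notation sp := (sp R).
Local Notation one := (@one R N).

Let N_gt0 : (0 < N)%N. Proof. by case: i => m; exact: leq_ltn_trans. Qed.
Let sN_gt0 : 0 < sN. Proof. by rewrite sqrtr_gt0 ltr0n. Qed.
Let sN_neq0 : sN != 0. Proof. by rewrite gt_eqF. Qed.
Let sN2 : sN * sN = N%:R. Proof. by rewrite -expr2 sqr_sqrtr. Qed.
Let sNN : sN^-1 * N%:R = sN.
Proof. by apply: (mulfI sN_neq0); rewrite mulrA divff ?mul1r ?sN2. Qed.
Let w0 g s := @gibbs_ge0 R N beta h g s.
Let w1 g := @gibbs_sum R N beta h g.

(** * The local field at site i and its second moment *)

Definition bpair (k : 'I_N) : idx := if (i < k)%N then (i, k) else (k, i).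

Lemma bpair_lt k : k != i -> ((bpair k).1 < (bpair k).2)%N.
Proof. by rewrite /bpair neq_ltn; case: ltngtP. Qed.

Lemma gsym_bpair (g : dis) k : gsym g i k = g (bpair k).1 (bpair k).2.
Proof. by rewrite /gsym /bpair; case: ifP. Qed.

Lemma bond_bpair k : bond R (bpair k) =1 si \* sp k.
Proof. by move=> s; rewrite /bond /bpair /sp; case: ifP => //= _; rewrite mulrC. Qed.

Lemma smooth_gsym (j k : 'I_N) : j != i -> k != i ->
  smooth_along (bpair k) (fun g : dis => gsym g i j) (fun _ => (j == k)%:R).
Proof.
move=> ji ki; have sc := @smooth_coord R N (bpair k) (bpair j).1 (bpair j).2.
apply: (smooth_along_eq sc) => g.
  by rewrite gsym_bpair.
suff -> : ((bpair j).1 == (bpair k).1) && ((bpair j).2 == (bpair k).2) = (j == k) by case: eqP.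
rewrite /bpair; case: ltnP => ij; case: ltnP => ik /=; rewrite ?eqxx ?andbT//.
- rewrite [i == k]eq_sym (negbTE ki) /=; apply/esym/negbTE; apply: contraTneq ij => ->.
  by rewrite -leqNgt.
- rewrite (negbTE ji) /=; apply/esym/negbTE; apply: contraTneq ik => <-.
  by rewrite -leqNgt.
Qed.

(** The l of the overview, as a function of the configuration. *)
Definition field (g : dis) (s : conf) : R := sN^-1 * \sum_(k | k != i) gsym g i k * sp k s.

Lemma smooth_field k s : k != i ->
  smooth_along (bpair k) (fun g => field g s) (fun _ => sp k s / sN).
Proof.
move=> ki.
have s1 : smooth_along (bpair k) (fun g : dis => \sum_(j | j != i) sp j s * gsym g i j)
    (fun _ => \sum_(j | j != i) sp j s * (j == k)%:R).
  by apply: smooth_sum => j ji; apply: smoothZ; exact: smooth_gsym.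
apply: (smooth_along_eq (smoothZ sN^-1 s1)) => g.
  by rewrite /field; congr (_ * _); apply: eq_bigr => j _; rewrite mulrC.
rewrite mulrC (bigD1 k)//= eqxx mulr1 big1 ?addr0// => j /andP[_ /negPf ->].
by rewrite mulr0.
Qed.

Definition fld1 g := wE (w g) (field g).
Definition fldi g := wE (w g) (field g \* si).
Definition fld2 g := wE (w g) (fun s => field g s ^+ 2).
Definition ci g := wE (w g) si.

Lemma smooth_av k (A : conf -> R) : k != i ->
  smooth_along (bpair k) (fun g => wE (w g) A) (fun g => b0 * Mk (w g) i k A).
Proof.
move=> ki.
apply: (smooth_along_eq (smooth_wE beta h (bpair_lt ki) (fun s => smooth_cst (bpair k) (A s)))) => // g.
rewrite {1}/wE big1 ?add0r; last by move=> s _; rewrite mulr0.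
congr (_ * (_ - _ * _)); apply: wE_ext => s /=; first by rewrite bond_bpair mulrA.
exact: bond_bpair.
Qed.

Lemma smooth_av_field k (B : conf -> R) : k != i ->
  smooth_along (bpair k) (fun g => wE (w g) (field g \* B))
    (fun g => wE (w g) (sp k \* B) / sN + b0 * Mk (w g) i k (field g \* B)).
Proof.
move=> ki.
have sA s : smooth_along (bpair k) (fun g => field g s * B s) (fun _ => sp k s * B s / sN).
  apply: (smooth_along_eq (smoothM (smooth_field s ki) (smooth_cst (bpair k) (B s)))) => // g.
  by rewrite mulr0 addr0 mulrAC.
apply: (smooth_along_eq (smooth_wE beta h (bpair_lt ki) sA)) => // g.
congr (_ + _ * (_ - _ * _)).
- by rewrite mulrC -wEZ; apply: wE_ext => s; rewrite mulrC.
- by apply: wE_ext => s /=; rewrite bond_bpair mulrA.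
- by apply: wE_ext => s; exact: bond_bpair.
Qed.

Lemma Mk_ext k g A B : A =1 B -> Mk (w g) i k A = Mk (w g) i k B.
Proof.
by move=> AB; rewrite /Mk; congr (_ - _ * _); apply: wE_ext => s //=; rewrite AB.
Qed.

Lemma smooth_fld1 k : k != i -> smooth_along (bpair k) fld1
  (fun g => wE (w g) (sp k) / sN + b0 * Mk (w g) i k (field g)).
Proof.
move=> ki; apply: (smooth_along_eq (smooth_av_field one ki)) => g.
  by apply: wE_ext => s /=; rewrite mulr1.
congr (_ / _ + _ * _); first by apply: wE_ext => s /=; rewrite mulr1.
by apply: Mk_ext => s /=; rewrite mulr1.
Qed.

Lemma regular_gsym k : regular (fun g : dis => gsym g i k).
Proof. by under eq_fun do rewrite gsym_bpair; exact: regular_coord. Qed.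

(** Integration by parts in all couplings at i at once; this is the only form used below. *)
Lemma ibp_sum (F dF : 'I_N -> dis -> R) :
  (forall k, k != i -> smooth_along (bpair k) (F k) (dF k)) ->
  disE (fun g => sN^-1 * \sum_(k | k != i) gsym g i k * F k g) =
  disE (fun g => sN^-1 * \sum_(k | k != i) dF k g).
Proof.
move=> sF.
have r1 k : k != i -> regular (fun g => gsym g i k * F k g).
  by move=> ki; apply: regularM; [exact: regular_gsym|exact: smooth_reg (sF k ki)].
have r2 k : k != i -> regular (dF k) by move=> ki; exact: smooth_dreg (sF k ki).
rewrite !disEZ; [|exact: regular_sum|exact: regular_sum].
congr (_ * _); rewrite !disE_sum//; apply: eq_bigr => k ki.
rewrite -(disE_ibp (bpair_lt ki) (sF k ki)); congr disE; apply/funext => g.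
by rewrite gsym_bpair.
Qed.

Lemma wE_field g (B : conf -> R) : wE (w g) (field g \* B) =
  sN^-1 * \sum_(k | k != i) gsym g i k * wE (w g) (sp k \* B).
Proof.
under [in RHS]eq_bigr do rewrite /wE mulr_sumr.
rewrite exchange_big mulr_sumr; apply: eq_bigr => s _ /=.
rewrite [LHS](_ : _ = sN^-1 * ((\sum_(k | k != i) gsym g i k * sp k s) * (w g s * B s))).
  by congr (_ * _); rewrite mulr_suml; apply: eq_bigr => k _; ring.
by rewrite /field; ring.
Qed.

Lemma regular_wE_field (B : conf -> R) : regular (fun g => wE (w g) (field g \* B)).
Proof.
under eq_fun do rewrite wE_field; apply: regularM; first exact: regular_cst.
apply: regular_sum => k _; apply: regularM; first exact: regular_gsym.
by apply: regular_wE => s; exact: regular_cst.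
Qed.

Lemma regular_fieldE : (forall s, regular (fun g => field g s)).
Proof.
move=> s; apply: regularM; first exact: regular_cst.
by apply: regular_sum => k _; apply: regularM; [exact: regular_gsym|exact: regular_cst].
Qed.

Lemma regular_fld2 : regular fld2.
Proof. by apply: regular_wE => s; apply: regularX; exact: regular_fieldE. Qed.

Lemma fld2_ge0 g : 0 <= fld2 g.
Proof. by apply: sumr_ge0 => s _; apply: mulr_ge0; [exact: w0|exact: sqr_ge0]. Qed.

Lemma regular_fld1 : regular fld1.
Proof. by apply: regular_wE => s; exact: regular_fieldE. Qed.

(* Self-bounding: integration by parts gives E<l^2> <= 1 + 2 beta E<|l|>. *)
Lemma disE_fld2 : disE fld2 <= 2 * (1 + 2 * beta ^+ 2).
Proof.
have e1 : disE fld2 = disE (fun g => sN^-1 * \sum_(k | k != i) gsym g i k * wE (w g) (field g \* sp k)).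
  congr disE; apply/funext => g; rewrite /fld2 (_ : wE _ _ = wE (w g) (field g \* field g)); last first.
    by apply: wE_ext => s; rewrite expr2.
  rewrite wE_field; congr (_ * _); apply: eq_bigr => k _; congr (_ * _).
  by apply: wE_ext => s /=; rewrite mulrC.
have e2 := ibp_sum (fun k ki => smooth_av_field (sp k) ki); rewrite -e1 in e2.
(* With a = <|l|>, 2 beta a <= 2 beta^2 + a^2/2 and a^2 <= <l^2>; half of E<l^2> is then absorbed on
   the left. *)
suff : disE fld2 <= 1 + 2 * beta ^+ 2 + 2^-1 * disE fld2 by lra.
rewrite {1}e2.
rewrite -disEZ; last exact: regular_fld2.
rewrite -[X in X + _](@disE_cst R N) -disED; [|exact: regular_cst|]; last first.
  by apply: regularM; [exact: regular_cst|exact: regular_fld2].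
apply: disE_le.
- apply: regularM; first exact: regular_cst.
  by apply: regular_sum => k ki; exact: smooth_dreg (smooth_av_field (sp k) ki).
- apply: regularD; first exact: regular_cst.
  by apply: regularM; [exact: regular_cst|exact: regular_fld2].
move=> g.
have term k : wE (w g) (sp k \* sp k) / sN + b0 * Mk (w g) i k (field g \* sp k) <=
    sN^-1 * (1 + 2 * beta ^+ 2 + 2^-1 * fld2 g).
  have -> : wE (w g) (sp k \* sp k) = 1.
    by rewrite -(wE_cst (w1 g) 1); apply: wE_ext => s /=; rewrite spK.
  rewrite mul1r [beta / sN]mulrC -mulrA -[X in X + _]mulr1 -mulrDr ler_wpM2l ?invr_ge0 ?sqrtr_ge0//.
  rewrite -addrA lerD2l.
  pose al := wE (w g) (fun s => `|field g s|).
  have al2 : al ^+ 2 <= fld2 g.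
    rewrite (le_trans (wE_sqr (w0 g) (w1 g) _))// /fld2 le_eqVlt; apply/orP; left; apply/eqP.
    by apply: wE_ext => s; rewrite real_normK// num_real.
  have m1 : `|wE (w g) ((field g \* sp k) \* si \* sp k)| <= al.
    rewrite (le_trans (wE_norm (w0 g) _))//; apply: (wE_le (w0 g)) => s /=.
    by rewrite !normrM !sp_norm !mulr1.
  have m2 : `|wE (w g) (field g \* sp k)| <= al.
    rewrite (le_trans (wE_norm (w0 g) _))//; apply: (wE_le (w0 g)) => s /=.
    by rewrite !normrM !sp_norm !mulr1.
  have m3 : `|wE (w g) (si \* sp k)| <= 1.
    by apply: (wE_norm_le1 (w0 g) (w1 g)) => s /=; rewrite normrM !sp_norm mulr1.
  have M2 : Mk (w g) i k (field g \* sp k) <= 2 * al.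
    rewrite (le_trans (ler_norm _))// (le_trans (ler_normB _ _))// mulr2n mulrDl mul1r.
    by rewrite lerD// normrM -[leRHS]mulr1 ler_pM.
  have := ler_wpM2l (ltW beta_gt0) M2; have := sqr_ge0 (2 * beta - al).
  rewrite !expr2 in al2 *; nra.
have B0 : 0 <= 1 + 2 * beta ^+ 2 + 2^-1 * fld2 g.
  by rewrite !addr_ge0// mulr_ge0 ?sqr_ge0 ?fld2_ge0.
apply: (@le_trans _ _ (sN^-1 * \sum_(k : 'I_N) sN^-1 * (1 + 2 * beta ^+ 2 + 2^-1 * fld2 g))).
  rewrite ler_wpM2l ?invr_ge0 ?sqrtr_ge0//.
  rewrite (le_trans (ler_sum _ (fun k _ => term k)))// big_mkcond; apply: ler_sum => k _.
  by case: ifP => // _; rewrite mulr_ge0// invr_ge0 sqrtr_ge0.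
rewrite sumr_const card_ord -[(_ * _) *+ N]mulr_natl.
by rewrite mulrA sNN mulrA divff// mul1r.
Qed.


(* [V] measures how far the local field is from satisfying the linear-response
   identity <l s_i> - <l><s_i> = beta (1 - q) (1 - <s_i>^2). *)
Definition Vi g := fldi g - ci g * fld1 g - beta * (1 - q) * (1 - ci g * ci g).

(** The covariance of the local field with s_i is written as a sum of couplings with coefficients
    [mk], the form to which [ibp_sum] applies. *)
Lemma fldi_sub g : fldi g - ci g * fld1 g = sN^-1 * \sum_(k | k != i) gsym g i k * mk (w g) i k.
Proof.
have -> : fld1 g = wE (w g) (field g \* one) by apply: wE_ext => s /=; rewrite mulr1.
rewrite /fldi !wE_field mulrCA -mulrBr; congr (_ * _).
rewrite mulr_sumr -sumrB; apply: eq_bigr => k _.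
rewrite /mk /ci mulrBr mulrCA; congr (_ * _ - _ * (_ * _)); apply: wE_ext => s /=; first by rewrite mulrC.
by rewrite mulr1.
Qed.

Lemma smooth_mk k : k != i ->
  smooth_along (bpair k) (fun g => mk (w g) i k) (fun g => b0 * dmk (w g) i k).
Proof.
move=> ki; apply: (smooth_along_eq (smoothB (smooth_av (si \* sp k) ki)
  (smoothM (smooth_av si ki) (smooth_av (sp k) ki)))) => // g.
by rewrite /dmk; ring.
Qed.

Definition dVi k g := sN^-1 * mk (w g) i k + b0 * (Mk (w g) i k (field g \* si)
  - fld1 g * Mk (w g) i k si - ci g * Mk (w g) i k (field g))
  + 2 * beta * (1 - q) * b0 * ci g * Mk (w g) i k si.

Lemma smooth_Vi k : k != i -> smooth_along (bpair k) Vi (dVi k).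
Proof.
move=> ki; have sc := smooth_av si ki.
have sV := smoothB (smoothB (smooth_av_field si ki) (smoothM sc (smooth_fld1 ki)))
  (smoothZ (beta * (1 - q)) (smoothB (smooth_cst (bpair k) 1) (smoothM sc sc))).
apply: (smooth_along_eq sV) => // g; rewrite /dVi /mk /ci /fld1.
have -> : wE (w g) (sp k \* si) = wE (w g) (si \* sp k) by apply: wE_ext => s /=; rewrite mulrC.
by move: (sN^-1) => n; ring.
Qed.

Lemma regular_ci : regular ci.
Proof. by apply: regular_wE => s; exact: regular_cst. Qed.

Lemma regular_Vi : regular Vi.
Proof.
apply: regularB; first apply: regularB.
- exact: regular_wE_field.
- by apply: regularM; [exact: regular_ci|exact: regular_fld1].
- apply: regularM; first exact: regular_cst.
  by apply: regularB; [exact: regular_cst|apply: regularM; exact: regular_ci].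
Qed.

Lemma ci_le1 g : `|ci g| <= 1.
Proof. by apply: (wE_norm_le1 (w0 g) (w1 g)) => s; rewrite sp_norm. Qed.

(** * A common budget for the replacement errors; e stands for N^(-1/4) *)

Variable e : R.
Hypotheses (e_gt0 : 0 < e) (eN : e ^+ 4 * N%:R = 1).

Let e_le1 : e <= 1.
Proof.
rewrite leNgt; apply/negP => e1.
have : 1 < e ^+ 4 * N%:R.
  have e4 : 1 < e ^+ 4 by rewrite exprn_egt1.
  by apply: (lt_le_trans e4); apply: ler_peMr; [exact/ltW/(lt_trans _ e4)|rewrite ler1n].
by rewrite eN ltxx.
Qed.

(** The right-hand side of [rho_bound] with weight e^2, up to a constant. The 1 serves bounded
    observables and [fld2] those containing the local field. Its expectation is O(e^2), as E [fld2]
    = O(1) and E [rr] = O(e^4). *)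
Definition err g := e ^+ 2 * (1 + fld2 g) + rr (w g) q / e ^+ 2.

Let rr0 g := rr_ge0 (w0 g) q.

Lemma regular_overlap (f : conf -> conf -> R) : regular (fun g => wE2 (w g) f).
Proof.
apply: regular_sum => s _; apply: regular_sum => t _.
by apply: regularM; [apply: regularM; exact: regular_gibbs|exact: regular_cst].
Qed.

Lemma regular_err : regular err.
Proof.
apply: regularD; apply: regularM; try exact: regular_cst.
- by apply: regularD; [exact: regular_cst|exact: regular_fld2].
- exact: regular_overlap.
Qed.

Lemma err_ge0 g : 0 <= err g.
Proof.
by rewrite /err addr_ge0 ?divr_ge0 ?mulr_ge0 ?exprn_ge0 ?(ltW e_gt0)// addr_ge0// fld2_ge0.
Qed.

Lemma rr_err g : rr (w g) q <= err g.
Proof.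
have le1 : rr (w g) q <= rr (w g) q / e ^+ 2.
  by rewrite ler_pdivlMr ?exprn_gt0// ler_piMr// exprn_ile1// ltW.
by rewrite (le_trans le1)// lerDr mulr_ge0 ?exprn_ge0 ?(ltW e_gt0)// addr_ge0// fld2_ge0.
Qed.

(** [rho_bound] with weight e^2, where the 4 in its denominator is given up; l is whatever dominates
    the second observable. *)
Lemma rho_err y g (A B l : conf -> R) : (forall s, `|A s| <= 1) ->
  (forall s, `|y * B s| <= `|l s|) -> wE (w g) (fun s => l s ^+ 2) <= 1 + fld2 g ->
  `|y * rho (w g) q A B| <= err g.
Proof.
move=> A1 Bl l2; have e20 : 0 < e ^+ 2 by rewrite exprn_gt0.
rewrite (le_trans (rho_bound (w0 g) (w1 g) q e20 A1 Bl))//.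
apply: lerD; first by rewrite ler_wpM2l// ltW.
rewrite ler_wpM2l// lef_pV2 ?posrE ?mulr_gt0//.
by apply: ler_peMl; [exact: ltW|rewrite ler1n].
Qed.

Let sp1 (k : 'I_N) (s : conf) : `|sp k s| <= 1. Proof. by rewrite sp_norm. Qed.
Let one1 (s : conf) : `|one s| <= 1. Proof. by rewrite normr1. Qed.

Lemma rho_err1 y g A B : `|y| <= 1 -> (forall s, `|A s| <= 1) -> (forall s, `|B s| <= 1) ->
  `|y * rho (w g) q A B| <= err g.
Proof.
move=> y1 A1 B1; apply: (@rho_err _ _ _ _ one) => //.
  by move=> s; rewrite normrM normr1 -[leRHS]mulr1 ler_pM.
have -> : wE (w g) (fun s => one s ^+ 2) = 1.
  by rewrite -(wE_cst (w1 g) 1); apply: wE_ext => s; rewrite expr1n.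
by rewrite lerDl fld2_ge0.
Qed.

Lemma rho_errF y g A B : `|y| <= 1 -> (forall s, `|A s| <= 1) -> (forall s, `|B s| <= `|field g s|) ->
  `|y * rho (w g) q A B| <= err g.
Proof.
move=> y1 A1 B1; apply: (@rho_err _ _ _ _ (field g)) => //.
  by move=> s; rewrite normrM -[leRHS]mul1r ler_pM.
by rewrite lerDr.
Qed.

(** The prefactor <C> enters the dominating function as a constant; Jensen bounds its square by
    <C^2>, hence by [fld2]. *)
Lemma rho_errM y g A B C : `|y| <= 1 -> (forall s, `|A s| <= 1) -> (forall s, `|B s| <= 1) ->
  (forall s, `|C s| <= `|field g s|) -> `|y * wE (w g) C * rho (w g) q A B| <= err g.
Proof.
move=> y1 A1 B1 C1; apply: (@rho_err _ _ _ _ (fun _ => wE (w g) C)) => //.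
  by move=> s; rewrite !normrM -[leRHS]mul1r -[leRHS]mulr1 ler_pM ?mulr_ge0// ler_pM.
rewrite wE_cst// (le_trans (wE_sqr (w0 g) (w1 g) _))//.
rewrite (@le_trans _ _ (fld2 g)) ?lerDr//; apply: (wE_le (w0 g)) => s.
by rewrite -(real_normK (num_real (C s))) -(real_normK (num_real (field g s))) lerXn2r ?nnegrE.
Qed.


Let sNsN : sN^-1 * sN^-1 = N%:R^-1. Proof. by rewrite -invfM sN2. Qed.
Let Nn0 : N%:R != 0 :> R. Proof. by rewrite pnatr_eq0 -lt0n. Qed.

Local Notation rh g := (rho (w g) q).

(* [N^-1 sum_k mk k * Mk k A] in terms of centred overlaps: all the terms
   proportional to [q] cancel. *)
Definition T2 g (A : conf -> R) := rh g si (A \* si) - wE (w g) A * rh g si si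
  - ci g * rh g one (A \* si) + ci g * wE (w g) A * rh g one si.

Lemma sumT2 g A : N%:R^-1 * (\sum_(k | k != i) mk (w g) i k * Mk (w g) i k A) = T2 g A.
Proof. by rewrite (sum_mk_Mk (w1 g) q N_gt0) mulrA mulVf// mul1r. Qed.

Let Asi1 (A : conf -> R) g : (forall s, `|A s| <= g s) -> forall s, `|(A \* si) s| <= g s.
Proof. by move=> Ag s; rewrite /= normrM sp_norm mulr1. Qed.

Lemma ler_norm4 (a b c d x : R) : `|a| <= x -> `|b| <= x -> `|c| <= x -> `|d| <= x ->
  `|a - b - c + d| <= 4 * x.
Proof.
move=> ha hb hc hd; rewrite (le_trans (ler_normD _ _))//.
have h1 := ler_normB (a - b) c; have h2 := ler_normB a b; lra.
Qed.

Lemma T2_field y g A : `|y| <= 1 -> (forall s, `|A s| <= `|field g s|) -> `|y * T2 g A| <= 4 * err g.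
Proof.
move=> y1 A1.
have yc : `|y * ci g| <= 1 by rewrite normrM -[leRHS]mulr1 ler_pM// ci_le1.
have -> : y * T2 g A = y * rh g si (A \* si) - y * wE (w g) A * rh g si si
  - y * ci g * rh g one (A \* si) + y * ci g * wE (w g) A * rh g one si by rewrite /T2; ring.
by apply: ler_norm4; [apply: rho_errF|apply: rho_errM|apply: rho_errF|apply: rho_errM] => //;
  exact: Asi1.
Qed.

Lemma T2_si y g C : `|y| <= 1 -> (forall s, `|C s| <= `|field g s|) ->
  `|y * wE (w g) C * T2 g si| <= 4 * err g.
Proof.
move=> y1 C1; have ss : forall s, `|(si \* si) s| <= 1 by apply: Asi1.
have yc : `|y * ci g| <= 1 by rewrite normrM -[leRHS]mulr1 ler_pM// ci_le1.
have ycc : `|y * ci g * ci g| <= 1 by rewrite normrM -[leRHS]mulr1 ler_pM// ci_le1.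
have -> : y * wE (w g) C * T2 g si = y * wE (w g) C * rh g si (si \* si)
  - y * ci g * wE (w g) C * rh g si si - y * ci g * wE (w g) C * rh g one (si \* si)
  + y * ci g * ci g * wE (w g) C * rh g one si by rewrite /T2 /ci; ring.
by apply: ler_norm4; apply: rho_errM.
Qed.

Lemma T2_si1 y g : `|y| <= 1 -> `|y * T2 g si| <= 4 * err g.
Proof.
move=> y1; have ss : forall s, `|(si \* si) s| <= 1 by apply: Asi1.
have yc : `|y * ci g| <= 1 by rewrite normrM -[leRHS]mulr1 ler_pM// ci_le1.
have ycc : `|y * ci g * ci g| <= 1 by rewrite normrM -[leRHS]mulr1 ler_pM// ci_le1.
have -> : y * T2 g si = y * rh g si (si \* si)
  - y * ci g * rh g si si - y * ci g * rh g one (si \* si)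
  + y * ci g * ci g * rh g one si by rewrite /T2 /ci; ring.
by apply: ler_norm4; apply: rho_err1.
Qed.

(** The first summand contains beta (1 - q) V (1 - c^2), exactly V times the term subtracted in
    [Vi]; the rest is controlled by centred overlaps. *)
Lemma sum_dF2 g : sN^-1 * (\sum_(k | k != i) (b0 * dmk (w g) i k * Vi g + mk (w g) i k * dVi k g)) =
  beta * Vi g * ((1 - q) * (1 - ci g ^+ 2) - rh g si si + 2 * ci g * rh g one si - rh g one one)
  + N%:R^-1 * (\sum_(k | k != i) mk (w g) i k ^+ 2)
  + beta * (T2 g (field g \* si) - fld1 g * T2 g si - ci g * T2 g (field g))
  + 2 * beta ^+ 2 * (1 - q) * ci g * T2 g si.
Proof.
have -> : (1 - q) * (1 - ci g ^+ 2) - rh g si si + 2 * ci g * rh g one si - rh g one one =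
    N%:R^-1 * \sum_(k | k != i) dmk (w g) i k.
  by rewrite (sum_dmk (w1 g) q N_gt0) mulrA mulVf// mul1r.
rewrite -!sumT2 -sNsN.
have -> : \sum_(k | k != i) (b0 * dmk (w g) i k * Vi g + mk (w g) i k * dVi k g) =
  b0 * Vi g * (\sum_(k | k != i) dmk (w g) i k) + sN^-1 * (\sum_(k | k != i) mk (w g) i k ^+ 2)
  + b0 * (\sum_(k | k != i) mk (w g) i k * Mk (w g) i k (field g \* si))
  + (2 * beta * (1 - q) * b0 * ci g - b0 * fld1 g) * (\sum_(k | k != i) mk (w g) i k * Mk (w g) i k si)
  + (- (b0 * ci g)) * (\sum_(k | k != i) mk (w g) i k * Mk (w g) i k (field g)).
  rewrite sum_lin5; apply: eq_bigr => k _ /=; rewrite /dVi.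
  by move: (sN^-1) => n; ring.
by move: (sN^-1) => n; ring.
Qed.

(** The 16 beta^2 comes from four overlap errors multiplied by beta V, 4 beta^2 each; the 4 from the
    squares of [mk]; 12 beta from three [T2] terms involving the field; 8 beta^2 from the last [T2]
    term. The outer 2 undoes the absorption of half of V^2. *)
Definition CV : R := 2 * (16 * beta ^+ 2 + 4 + 12 * beta + 8 * beta ^+ 2).

Lemma pointwise_V2 g :
  sN^-1 * (\sum_(k | k != i) (b0 * dmk (w g) i k * Vi g + mk (w g) i k * dVi k g))
  - beta * (1 - q) * (Vi g * (1 - ci g * ci g)) <= 2^-1 * (Vi g * Vi g) + 2^-1 * CV * err g.
Proof.
rewrite sum_dF2; have c1 := ci_le1 g; have e0 := err_ge0 g.
have n1 : `|1| <= 1 :> R by rewrite normr1.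
have nm1 : `|-1| <= 1 :> R by rewrite normrN normr1.
have V0 : 0 < 16 * beta ^+ 2 by rewrite mulr_gt0// exprn_gt0.
(* Here beta V takes the role of l, with weight 1/(16 beta^2). Each occurrence costs V^2/16, and
   four of them stay below the V^2/2 to be absorbed. *)
have bV y A B : `|y| <= 1 -> (forall s, `|A s| <= 1) -> (forall s, `|B s| <= 1) ->
    beta * Vi g * (y * rh g A B) <= 16^-1 * (Vi g * Vi g) + 4 * beta ^+ 2 * err g.
  move=> y1 A1 B1; have dl0 : 0 < (16 * beta ^+ 2)^-1 by rewrite invr_gt0.
  have := @rho_bound R N (w g) (w0 g) (w1 g) q _ (beta * Vi g * y) A B (fun _ => beta * Vi g) dl0 A1.
  rewrite wE_cst// => /(_ _) hb.
  rewrite mulrA (le_trans (ler_norm _))// (le_trans (hb _))//.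
    by move=> s; rewrite !normrM -[leRHS]mulr1 -[leRHS]mulr1 ler_pM ?mulr_ge0// ler_pM ?mulr_ge0.
  apply: lerD.
    by rewrite le_eqVlt; apply/orP; left; apply/eqP; field; rewrite gt_eqF.
  rewrite (_ : (4 * (16 * beta ^+ 2)^-1) = (4 * beta ^+ 2)^-1); last by field; rewrite gt_eqF.
  by rewrite invrK mulrC ler_wpM2l ?rr_err// mulr_ge0// exprn_ge0// ltW.
have b1 := bV (-1) si si nm1 (sp1 i) (sp1 i).
have b2 := bV (ci g) one si c1 one1 (sp1 i).
have b3 := bV (-1) one one nm1 one1 one1.
have sq : N%:R^-1 * (\sum_(k | k != i) mk (w g) i k ^+ 2) <= 4 * err g.
  rewrite (@le_trans _ _ (rh g si si - 2 * ci g * rh g one si + ci g ^+ 2 * rh g one one))//.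
    rewrite [leLHS]mulrC ler_pdivrMr ?ltr0n// [leRHS]mulrC.
    exact: (sum_mk_sqr (w1 g) q N_gt0 i).
  have a1 := rho_err1 g n1 (sp1 i) (sp1 i).
  have a2 := rho_err1 g c1 one1 (sp1 i).
  have c2 : `|ci g ^+ 2| <= 1 by rewrite normrX exprn_ile1.
  have a3 := rho_err1 g c2 one1 one1.
  move: a1 a2 a3; rewrite mul1r !ler_norml => /andP[_ a1] /andP[a2 _] /andP[_ a3].
  by rewrite -mulrA; lra.
have f1 s : `|field g s| <= `|field g s| by [].
have t1 := T2_field n1 (Asi1 f1).
have t2 := T2_si n1 f1.
have t3 := T2_field c1 f1.
have t4 := T2_si1 g c1.
have bq : 0 <= 2 * beta ^+ 2 * (1 - q) <= 2 * beta ^+ 2.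
  have q1 : 0 <= 1 - q <= 1 by case/andP: q01 => ? ?; apply/andP; split; lra.
  case/andP: q1 => qa qb; rewrite !mulr_ge0 ?exprn_ge0 ?(ltW beta_gt0)//=.
  by rewrite ler_piMr// mulr_ge0// exprn_ge0// ltW.
have t4' : 2 * beta ^+ 2 * (1 - q) * ci g * T2 g si <= 8 * beta ^+ 2 * err g.
  rewrite -mulrA (@le_trans _ _ (2 * beta ^+ 2 * (1 - q) * (4 * err g)))//.
    by case/andP: bq => bq _; rewrite ler_wpM2l// (le_trans (ler_norm _)).
  case/andP: bq => _ bq; have := ler_wpM2r (mulr_ge0 (ler0n _ 4) e0) bq.
  by move/le_trans; apply; lra.
have t123 : beta * (T2 g (field g \* si) - fld1 g * T2 g si - ci g * T2 g (field g)) <= 12 * beta * err g.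
  have -> : 12 * beta * err g = beta * (12 * err g) by ring.
  rewrite ler_wpM2l ?(ltW beta_gt0)//.
  move: t1 t2 t3; rewrite !mul1r !ler_norml -/(fld1 g) => /andP[_ t1] /andP[t2 _] /andP[t3 _].
  by lra.
have -> : beta * Vi g * ((1 - q) * (1 - ci g ^+ 2) - rh g si si + 2 * ci g * rh g one si - rh g one one)
  = beta * (1 - q) * (Vi g * (1 - ci g * ci g)) + beta * Vi g * (-1 * rh g si si)
    + 2 * (beta * Vi g * (ci g * rh g one si)) + beta * Vi g * (-1 * rh g one one) by ring.
have VV : 0 <= Vi g * Vi g by rewrite -expr2 sqr_ge0.
by rewrite /CV; lra.
Qed.

(** One factor V is rewritten by [fldi_sub] and integrated by parts against the other. The
    subtracted term removes the leading part, and half of E V^2 is absorbed. *)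
Lemma disE_V2 : disE (fun g => Vi g * Vi g) <= CV * disE err.
Proof.
have rV := regular_Vi; have rVV := regularM rV rV.
pose Q g := Vi g * (1 - ci g * ci g).
have rQ : regular Q.
  apply: regularM => //; apply: regularB; first exact: regular_cst.
  by apply: regularM; exact: regular_ci.
have sF k (ki : k != i) := smoothM (smooth_mk ki) (smooth_Vi ki).
have ibp := ibp_sum sF.
have rdF : regular (fun g => sN^-1 * \sum_(k | k != i) (b0 * dmk (w g) i k * Vi g + mk (w g) i k * dVi k g)).
  apply: regularM; first exact: regular_cst.
  by apply: regular_sum => k ki; exact: smooth_dreg (sF k ki).
have E1 : (fun g => Vi g * Vi g) =
    (fun g => sN^-1 * (\sum_(k | k != i) gsym g i k * (mk (w g) i k * Vi g)) - beta * (1 - q) * Q g).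
  apply/funext => g; rewrite /Q {1}/Vi fldi_sub.
  rewrite mulrBl -!mulrA mulr_suml; congr (_ * _ - _); last by ring.
  by apply: eq_bigr => k _; rewrite mulrA.
have rF : regular (fun g => sN^-1 * \sum_(k | k != i) gsym g i k * (mk (w g) i k * Vi g)).
  apply: regularM; first exact: regular_cst.
  apply: regular_sum => k ki; apply: regularM; first exact: regular_gsym.
  exact: smooth_reg (sF k ki).
have rcQ : regular (fun g => beta * (1 - q) * Q g) by apply: regularM => //; exact: regular_cst.
have : disE (fun g => Vi g * Vi g) <= 2^-1 * disE (fun g => Vi g * Vi g) + 2^-1 * CV * disE err.
  rewrite {1}E1 disEB// ibp -disEB// -disEZ// -[X in _ <= _ + X]disEZ; last exact: regular_err.
  have r1 : regular (fun g => 2^-1 * (Vi g * Vi g)) by apply: regularM => //; exact: regular_cst.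
  have r2 : regular (fun g => 2^-1 * CV * err g) by apply: regularM; [exact: regular_cst|exact: regular_err].
  rewrite -disED//; apply: disE_le; [exact: regularB|exact: regularD|].
  exact: pointwise_V2.
by lra.
Qed.

(** * Orders of magnitude from the fourth moment hypothesis *)

Variable C0 : R.
Hypothesis overlap4 : disE (fun g => avg2 beta h g (fun s t : conf => (overlap R s t - q) ^+ 4)) <= C0 / N%:R ^+ 2.

Let Ninv : N%:R^-1 = e ^+ 4. Proof. by rewrite -[RHS](mulfK Nn0) eN mul1r. Qed.

(** With x = R_12 - q, x^2 <= e^4/2 + x^4/(2 e^4); the scale e^4 = 1/N matches E<x^4> <= C0 e^8. *)
Lemma disE_rr : disE (fun g : dis => rr (w g) q) <= 2^-1 * (1 + C0) * e ^+ 4.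
Proof.
have r4 : regular (fun g : dis => wE2 (w g) (fun s t : conf => (overlap R s t - q) ^+ 4)) by exact: regular_overlap.
have e4 : 0 < e ^+ 4 by rewrite exprn_gt0.
have hb : disE (fun g : dis => rr (w g) q) <= 2^-1 * e ^+ 4 + 2^-1 / e ^+ 4 *
    disE (fun g : dis => wE2 (w g) (fun s t : conf => (overlap R s t - q) ^+ 4)).
  rewrite -disEZ// -[X in X + _](@disE_cst R N) -disED; [|exact: regular_cst|]; last first.
    by apply: regularM => //; exact: regular_cst.
  apply: disE_le; first exact: regular_overlap.
    by apply: regularD; [exact: regular_cst|apply: regularM => //; exact: regular_cst].
  move=> g; have -> : 2^-1 * e ^+ 4 = wE2 (w g) (fun s t => (2^-1 * e ^+ 4) * (one s * one t)).
    by rewrite (wE2Z _ (2^-1 * e ^+ 4)) (wE2_prod _ one one) /one !wE_cst ?mulr1.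
  rewrite -wE2Z -wE2D; apply: (wE2_le (w0 g)) => s t.
  rewrite /one !mulr1; set x := overlap R s t - q.
  have -> : x ^+ 4 = (x ^+ 2) ^+ 2 by rewrite -exprM.
  rewrite -subr_ge0 (_ : _ - _ = 2^-1 / e ^+ 4 * (e ^+ 4 - x ^+ 2) ^+ 2).
    by rewrite mulr_ge0 ?sqr_ge0// divr_ge0// ltW.
  by field; rewrite gt_eqF.
rewrite (le_trans hb)//.
pose D4 := disE (fun g : dis => wE2 (w g) (fun s t : conf => (overlap R s t - q) ^+ 4)).
have o4 : D4 <= C0 / N%:R ^+ 2 by exact: overlap4.
have ei : 0 <= (e ^+ 4)^-1 by rewrite invr_ge0 ltW.
have := ler_wpM2l ei o4; rewrite -exprVn Ninv.
have -> : (e ^+ 4)^-1 * (C0 * (e ^+ 4) ^+ 2) = C0 * e ^+ 4 by field; rewrite gt_eqF.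
rewrite -/D4 => hc; rewrite -mulrA; lra.
Qed.

(** Collects the 1 in [err], the field bound [disE_fld2] and the overlap bound [disE_rr]. *)
Definition KS : R := 1 + 2 * (1 + 2 * beta ^+ 2) + 2^-1 * (1 + C0).

Lemma disE_err : disE err <= KS * e ^+ 2.
Proof.
have e2 : 0 < e ^+ 2 by rewrite exprn_gt0.
have r1 : regular (fun g : dis => rr (w g) q) by exact: regular_overlap.
have r2 : regular (fun g => 1 + fld2 g) by apply: regularD; [exact: regular_cst|exact: regular_fld2].
have -> : disE err = e ^+ 2 * (1 + disE fld2) + (e ^+ 2)^-1 * disE (fun g : dis => rr (w g) q).
  have -> : err = (fun g => e ^+ 2 * (1 + fld2 g) + (e ^+ 2)^-1 * rr (w g) q).
    by apply/funext => g; rewrite /err [_ / _]mulrC.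
  rewrite disED; [|by apply: regularM => //; exact: regular_cst..].
  rewrite !disEZ// disED; [|exact: regular_cst|exact: regular_fld2].
  by rewrite (@disE_cst R N).
have h1 := ler_wpM2l (ltW e2) disE_fld2.
have ei : 0 <= (e ^+ 2)^-1 by rewrite invr_ge0 ltW.
have h2 := ler_wpM2l ei disE_rr.
have e3 : (e ^+ 2)^-1 * (2^-1 * (1 + C0) * e ^+ 4) = 2^-1 * (1 + C0) * e ^+ 2.
  by field; rewrite gt_eqF.
rewrite e3 in h2; rewrite /KS; lra.
Qed.

(** The sign is read off from 0 <= E [err] <= [KS] e^2, C0 being an arbitrary real. *)
Lemma KS_ge0 : 0 <= KS.
Proof.
have e2 : 0 < e ^+ 2 by rewrite exprn_gt0.
have : 0 <= disE err.
  rewrite -(@disE_cst R N 0); apply: disE_le; [exact: regular_cst|exact: regular_err|].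
  exact: err_ge0.
by move/le_trans => /(_ _ disE_err); rewrite pmulr_lge0.
Qed.

(** From |V| <= e/2 + V^2/(2 e) and E V^2 = O(e^2). This step fixes the rate at e rather than
    e^2. *)
Lemma disE_absV : disE (fun g => `|Vi g|) <= 2^-1 * (1 + CV * KS) * e.
Proof.
have rV := regular_Vi; have rVV := regularM rV rV.
have CV0 : 0 <= CV.
  by rewrite /CV !mulr_ge0// !addr_ge0// mulr_ge0// ?exprn_ge0// ltW.
have h1 : disE (fun g => `|Vi g|) <= 2^-1 * e + 2^-1 / e * disE (fun g => Vi g * Vi g).
  rewrite -disEZ// -[X in X + _](@disE_cst R N) -disED; [|exact: regular_cst|]; last first.
    by apply: regularM => //; exact: regular_cst.
  apply: disE_le; first exact: regular_abs.
    by apply: regularD; [exact: regular_cst|apply: regularM => //; exact: regular_cst].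
  move=> g; rewrite -[Vi g * Vi g]expr2 -(real_normK (num_real (Vi g))).
  rewrite -subr_ge0 (_ : _ - _ = 2^-1 / e * (e - `|Vi g|) ^+ 2).
    by rewrite mulr_ge0 ?sqr_ge0// divr_ge0// ltW.
  by field; rewrite gt_eqF.
rewrite (le_trans h1)//.
have h2 : disE (fun g => Vi g * Vi g) <= CV * (KS * e ^+ 2).
  by rewrite (le_trans disE_V2)// ler_wpM2l// disE_err.
have ei : 0 <= 2^-1 / e by rewrite divr_ge0// ltW.
have := ler_wpM2l ei h2.
have -> : 2^-1 / e * (CV * (KS * e ^+ 2)) = 2^-1 * CV * KS * e by field; rewrite gt_eqF.
by lra.
Qed.

(** * Stein's identity for the cavity field *)

Definition cav g := fld1 g - beta * (1 - q) * ci g.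

Lemma cavE g : cavity_r beta h q g i = cav g.
Proof.
rewrite /cavity_r /cav; congr (_ - _).
have -> : fld1 g = wE (w g) (field g \* one) by apply: wE_ext => s /=; rewrite mulr1.
rewrite wE_field mulrC; congr (_ * _); apply: eq_bigr => k _; congr (_ * _).
by apply: wE_ext => s /=; rewrite mulr1.
Qed.

Definition dcav k g := sN^-1 * (wE (w g) (sp k) + beta * Mk (w g) i k (field g)
  - beta ^+ 2 * (1 - q) * Mk (w g) i k si).

Lemma smooth_cav k : k != i -> smooth_along (bpair k) cav (dcav k).
Proof.
move=> ki; apply: (smooth_along_eq (smoothB (smooth_fld1 ki)
  (smoothZ (beta * (1 - q)) (smooth_av si ki)))) => // g.
by rewrite /dcav; move: (sN^-1) => n; ring.
Qed.

(** The D of the overview: up to the factor sqrt N / N, the sum over k of <s_k> times the response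
    of the cavity field to the coupling of i and k. *)
Definition Dcav g := N%:R^-1 * \sum_(k | k != i) wE (w g) (sp k) * (wE (w g) (sp k)
  + beta * Mk (w g) i k (field g) - beta ^+ 2 * (1 - q) * Mk (w g) i k si).

(** Replacing overlaps by q leaves q + beta q (<l s_i> - <l><s_i>) - beta^2 (1 - q) q (1 - <s_i>^2).
    The last term stems from the reaction term of the cavity field and completes the middle one to
    beta q V. *)
Lemma DcavE g : Dcav g - q = rh g one one - N%:R^-1 * ci g ^+ 2 + beta * q * Vi g
  + beta * (rh g one (field g \* si) - fld1 g * rh g one si)
  - beta ^+ 2 * (1 - q) * (rh g one one - ci g * rh g one si).
Proof.
have -> : Dcav g = N%:R^-1 * (1 * (\sum_(k | k != i) wE (w g) (sp k) * wE (w g) (sp k))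
  + beta * (\sum_(k | k != i) wE (w g) (sp k) * Mk (w g) i k (field g))
  + (- (beta ^+ 2 * (1 - q))) * (\sum_(k | k != i) wE (w g) (sp k) * Mk (w g) i k si)).
  rewrite /Dcav; congr (_ * _); rewrite sum_lin3; apply: eq_bigr => k _ /=.
  by ring.
rewrite (sum_sp_sqr (w1 g) q N_gt0) !(sum_sp_Mk (w1 g) q N_gt0).
rewrite (wE_ii (w1 g)) /Vi -!/(fld1 g) -!/(fldi g) -!/(ci g).
have -> : rh g one (si \* si) = rh g one one by apply: wE2_ext => s t /=; rewrite spK.
by field.
Qed.

Definition CD : R := 1 + 2 * beta + 2 * beta ^+ 2.

Lemma Dcav_bound g : `|Dcav g - q| <= CD * err g + e ^+ 4 + beta * q * `|Vi g|.
Proof.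
have c1 := ci_le1 g; have n1 : `|1| <= 1 :> R by rewrite normr1.
have f1 s : `|field g s| <= `|field g s| by [].
have a1 := rho_err1 g n1 one1 one1; have a2 := rho_err1 g c1 one1 (sp1 i).
have a3 := rho_errF n1 one1 (Asi1 f1); have a4 := rho_errM n1 one1 (sp1 i) f1.
rewrite !mul1r in a1 a3 a4; rewrite -/(fld1 g) in a4.
have e0 := err_ge0 g; case/andP: q01 => q0 q1; have b0' := ltW beta_gt0.
rewrite DcavE Ninv.
have h1 : `|beta * (rh g one (field g \* si) - fld1 g * rh g one si)| <= beta * (2 * err g).
  rewrite normrM ger0_norm// ler_wpM2l// (le_trans (ler_normB _ _))//; lra.
have h2 : `|beta ^+ 2 * (1 - q) * (rh g one one - ci g * rh g one si)| <= beta ^+ 2 * (2 * err g).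
  rewrite normrM ger0_norm; last by rewrite mulr_ge0 ?exprn_ge0// subr_ge0 ltW.
  rewrite -mulrA ler_wpM2l ?exprn_ge0//.
  have hh : `|rh g one one - ci g * rh g one si| <= 2 * err g.
    by rewrite (le_trans (ler_normB _ _))//; lra.
  by rewrite (le_trans (ler_wpM2l _ hh)) ?subr_ge0 ?(ltW q1)// ler_piMl ?mulr_ge0//; lra.
have h3 : `|e ^+ 4 * ci g ^+ 2| <= e ^+ 4.
  rewrite normrM ger0_norm ?exprn_ge0 ?(ltW e_gt0)// ler_piMr ?exprn_ge0 ?(ltW e_gt0)//.
  by rewrite normrX exprn_ile1.
have h4 : `|beta * q * Vi g| = beta * q * `|Vi g|.
  by rewrite normrM ger0_norm// mulr_ge0// ltW.
rewrite (le_trans (ler_normB _ _))// (le_trans (lerD (ler_normD _ _) (lexx _)))//.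
rewrite (le_trans (lerD (lerD (ler_normD _ _) (lexx _)) (lexx _)))// h4.
rewrite (le_trans (lerD (lerD (lerD (ler_normB _ _) (lexx _)) (lexx _)) (lexx _)))//.
by rewrite /CD; lra.
Qed.

Let sq := Num.sqrt q.
Let sq_gt0 : 0 < sq. Proof. by rewrite sqrtr_gt0; case/andP: q01. Qed.
Let sq2 : sq^-1 * sq^-1 = q^-1.
Proof. by rewrite -invfM -expr2 sqr_sqrtr//; case/andP: q01 => /ltW. Qed.

(** Overlap errors carry 1/q through 1 - D/q and 1/sqrt q through the f term. The separate 1/q
    belongs to the 1/N contribution. In the last summand the q of beta q V has cancelled 1/q. *)
Definition Cstein : R := (q^-1 * CD + sq^-1 * beta) * KS + q^-1 + beta * (2^-1 * (1 + CV * KS)).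

(** The reaction term - beta (1 - q) <s_i> cancels the beta (1 - q) <s_i> f(Y) produced when the
    derivative falls on <s_k>. What remains is f'(Y) (1 - D/q) and an overlap error. *)
Lemma stein_cavity (f df : R -> R) (K : R) :
  (forall x : R, is_derive x 1 f (df x)) -> continuous df ->
  (forall x, `|f x| <= K) -> (forall x, `|df x| <= K) ->
  `|disE (fun g => df (cav g / sq) - cav g / sq * f (cav g / sq))| <= K * Cstein * e.
Proof.
move=> fdf cdf fK dfK.
have K0 : 0 <= K by rewrite (le_trans _ (fK 0)).
pose Y g := sq^-1 * cav g.
have YE g : cav g / sq = Y g by rewrite mulrC.
under eq_fun do rewrite YE.
have sY k (ki : k != i) := smoothZ sq^-1 (smooth_cav ki).
have sf k (ki : k != i) := smooth_comp (sY k ki) fdf cdf fK dfK.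
have sF k (ki : k != i) := smoothM (smooth_av (sp k) ki) (sf k ki).
have ibp := ibp_sum sF.
have cf : continuous f.
  by move=> x; apply: differentiable_continuous; apply/derivable1_diffP; case: (fdf x).
have rcav : regular cav.
  apply: regularB; first exact: regular_fld1.
  by apply: regularM; [exact: regular_cst|exact: regular_ci].
have rY : regular Y by apply: regularM => //; exact: regular_cst.
have rcomp (u : R -> R) : continuous u -> (forall x, `|u x| <= K) -> regular (fun g => u (Y g)).
  move=> cu uK; apply: (@regular_bounded _ _ _ K) => // d T X mX.
  by apply: measurableT_comp; [exact: continuous_measurable_fun|exact: rY.1].
have rf := rcomp _ cf fK; have rdf := rcomp _ cdf dfK.
(* [A] holds what needs no integration by parts, f'(Y) and the reaction term; [B] is the field part,
   with the couplings in front. *)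
pose A g := df (Y g) + sq^-1 * beta * (1 - q) * ci g * f (Y g).
pose B g := sN^-1 * \sum_(k | k != i) gsym g i k * (wE (w g) (sp k) * f (Y g)).
pose B' g := sN^-1 * \sum_(k | k != i) (b0 * Mk (w g) i k (sp k) * f (Y g)
  + wE (w g) (sp k) * (df (Y g) * (sq^-1 * dcav k g))).
have eB : disE B = disE B' by exact: ibp.
have rA : regular A.
  apply: regularD => //; apply: regularM => //; apply: regularM; [exact: regular_cst|exact: regular_ci].
have rB : regular B.
  apply: regularM; first exact: regular_cst.
  apply: regular_sum => k ki; apply: regularM; first exact: regular_gsym.
  exact: smooth_reg (sF k ki).
have rB' : regular B'.
  apply: regularM; first exact: regular_cst.
  by apply: regular_sum => k ki; exact: smooth_dreg (sF k ki).
have rsB (G : dis -> R) : regular G -> regular (fun g => sq^-1 * G g).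
  by move=> rG; apply: regularM => //; exact: regular_cst.
have -> : disE (fun g => df (Y g) - Y g * f (Y g)) = disE (fun g => A g - sq^-1 * B' g).
  rewrite (disEB rA (rsB _ rB')) disEZ// -eB -disEZ// -(disEB rA (rsB _ rB)).
  congr disE; apply/funext => g; rewrite /A /B.
  have -> : sN^-1 * (\sum_(k | k != i) gsym g i k * (wE (w g) (sp k) * f (Y g))) = fld1 g * f (Y g).
    have -> : fld1 g = wE (w g) (field g \* one) by apply: wE_ext => s /=; rewrite mulr1.
    rewrite wE_field -mulrA mulr_suml; congr (_ * _); apply: eq_bigr => k _.
    by rewrite mulrA; congr (_ * _ * _); apply: wE_ext => s /=; rewrite mulr1.
  by rewrite {2}/Y /cav; ring.
have pw g : A g - sq^-1 * B' g = df (Y g) * (q^-1 * (q - Dcav g)) + sq^-1 * beta * f (Y g) * rh g one si.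
  have -> : B' g = beta * f (Y g) * ((1 - q) * ci g - rh g one si) + sq^-1 * df (Y g) * Dcav g.
    have -> : (1 - q) * ci g - rh g one si = N%:R^-1 * \sum_(k | k != i) Mk (w g) i k (sp k).
      by rewrite (sum_Mk_sp (w1 g) q N_gt0) mulrA mulVf// mul1r.
    rewrite /B' /Dcav -sNsN.
    have -> : \sum_(k | k != i) (b0 * Mk (w g) i k (sp k) * f (Y g)
        + wE (w g) (sp k) * (df (Y g) * (sq^-1 * dcav k g))) =
      b0 * f (Y g) * (\sum_(k | k != i) Mk (w g) i k (sp k)) +
      sN^-1 * sq^-1 * df (Y g) * (\sum_(k | k != i) wE (w g) (sp k) * (wE (w g) (sp k)
        + beta * Mk (w g) i k (field g) - beta ^+ 2 * (1 - q) * Mk (w g) i k si)).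
      rewrite mulr_sumr [X in _ = _ + X]mulr_sumr -big_split; apply: eq_bigr => k _ /=.
      by rewrite /dcav; move: (sN^-1) => n; ring.
    by move: (sN^-1) => n; ring.
  have qq : q^-1 * q = 1 by rewrite mulVf// gt_eqF//; case/andP: q01.
  rewrite [q^-1 * (q - _)]mulrBr qq /A.
  by rewrite -sq2; ring.
have rV : regular (fun g => `|Vi g|) by apply: regular_abs; exact: regular_Vi.
pose c1 := q^-1 * CD + sq^-1 * beta.
pose U g := K * c1 * err g + (K * q^-1 * e ^+ 4 + K * beta * `|Vi g|).
have rU1 : regular (fun g => K * c1 * err g) by apply: regularM; [exact: regular_cst|exact: regular_err].
have rU2 : regular (fun g => K * beta * `|Vi g|) by apply: regularM => //; exact: regular_cst.
have rU3 : regular (fun g => K * q^-1 * e ^+ 4 + K * beta * `|Vi g|) by apply: regularD => //; exact: regular_cst.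
have rU : regular U by exact: regularD.
have q0 : 0 < q by case/andP: q01.
have b0' := ltW beta_gt0.
have pU g : `|A g - sq^-1 * B' g| <= U g.
  rewrite pw (le_trans (ler_normD _ _))//.
  have n1 : `|1| <= 1 :> R by rewrite normr1.
  have a1 := rho_err1 g n1 one1 (sp1 i); rewrite mul1r in a1.
  have h1 : `|df (Y g) * (q^-1 * (q - Dcav g))| <= K * (q^-1 * (CD * err g + e ^+ 4 + beta * q * `|Vi g|)).
    rewrite normrM ler_pM// normrM ger0_norm ?invr_ge0 ?(ltW q0)//.
    by rewrite ler_wpM2l ?invr_ge0 ?(ltW q0)// distrC Dcav_bound.
  have h2 : `|sq^-1 * beta * f (Y g) * rh g one si| <= K * (sq^-1 * beta * err g).
    have s0 : 0 <= sq^-1 * beta by rewrite mulr_ge0// invr_ge0 ltW.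
    rewrite 2!normrM (ger0_norm s0) mulrAC [leLHS]mulrC; apply: ler_pM => //.
      exact: mulr_ge0 s0 (normr_ge0 _).
    exact: ler_wpM2l s0 _ _ a1.
  rewrite (le_trans (lerD h1 h2))// le_eqVlt; apply/orP; left; apply/eqP.
  by rewrite /U /c1; field; rewrite !gt_eqF.
rewrite (le_trans (disE_norm_le (regularB rA (rsB _ rB')) rU pU))//.
rewrite (disED rU1 rU3) (disED (regular_cst N (K * q^-1 * e ^+ 4)) rU2).
rewrite (disEZ (K * c1) regular_err) (disEZ (K * beta) rV) (@disE_cst R N).
have KS0 := KS_ge0; have e0 := ltW e_gt0.
have e2e : e ^+ 2 <= e by rewrite expr2 ler_piMr.
have e4e : e ^+ 4 <= e.
  by rewrite (le_trans _ e2e)// ler_wiXn2l.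
have c10 : 0 <= c1.
  rewrite /c1 addr_ge0// mulr_ge0// ?invr_ge0 ?(ltW q0)// ?(ltW sq_gt0)//.
  by rewrite /CD !addr_ge0// mulr_ge0// exprn_ge0.
have g1 : disE err <= KS * e by rewrite (le_trans disE_err)// ler_wpM2l.
have := ler_wpM2l (mulr_ge0 K0 c10) g1.
have := ler_wpM2l (mulr_ge0 K0 b0') disE_absV.
have qi : 0 <= K * q^-1 by rewrite mulr_ge0// invr_ge0 ltW.
have := ler_wpM2l qi e4e.
by rewrite /Cstein -/c1; lra.
Qed.

End Cavity.

(** * Total variation from continuous test functions *)

Section MeanLaw.
Variables (R : realType) (d : measure_display) (T : measurableType d) (P : probability T R) (Y : T -> R).
Hypothesis mY : measurable_fun setT Y.

Definition mean (f : R -> R) : R := \int[P]_t f (Y t).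

Definition bmeas (f : R -> R) := measurable_fun setT f /\ exists K, forall x, `|f x| <= K.

Lemma bmeas_integrable f : bmeas f -> P.-integrable setT (fun t => (f (Y t))%:E).
Proof.
move=> [mf [K fK]]; apply: (@le_integrable _ _ _ P _ _ _ (fun=> K%:E)) => //.
- by apply/measurable_EFinP; exact: measurableT_comp.
- by move=> t _; rewrite lee_fin (le_trans (fK _))// ler_norm.
- exact: finite_measure_integrable_cst.
Qed.

Lemma mean_le f g : bmeas f -> bmeas g -> (forall x, f x <= g x) -> mean f <= mean g.
Proof.
by move=> bf bg fg; apply: le_Rintegral => //; exact: bmeas_integrable.
Qed.

Lemma meanD f g : bmeas f -> bmeas g -> mean (fun x => f x + g x) = mean f + mean g.
Proof. by move=> bf bg; apply: RintegralD => //; exact: bmeas_integrable. Qed.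

Lemma meanZ c f : bmeas f -> mean (fun x => c * f x) = c * mean f.
Proof. by move=> bf; apply: RintegralZl => //; exact: bmeas_integrable. Qed.

Lemma mean_cst c : mean (fun _ => c) = c.
Proof. by rewrite /mean Rintegral_cst// (_ : fine _ = 1) ?mulr1// [X in fine X](@probability_setT _ _ _ P). Qed.

Lemma mean_cvg0 (f : nat -> R -> R) : (forall n, measurable_fun setT (f n)) ->
  (forall n x, `|f n x| <= 1) -> (forall x, f n x @[n --> \oo] --> (0 : R)) ->
  mean (f n) @[n --> \oo] --> (0 : R).
Proof.
move=> mf f1 f0.
have h : (\int[P]_t (f n (Y t))%:E @[n --> \oo] --> \int[P]_t (cst 0%:E t))%E.
  apply: (@dominated_cvg _ _ _ P setT measurableT _ _ (fun=> 1%:E)) => //.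
  - by move=> n; apply/measurable_EFinP; exact: measurableT_comp.
  - by move=> t _; apply: cvg_EFin; [exact: nearW|exact: f0].
  - exact: finite_measure_integrable_cst.
  - by move=> n t _; rewrite lee_fin f1.
rewrite integral_cst// mul0e in h.
exact: fine_cvg h.
Qed.

End MeanLaw.

Lemma bmeas_continuous (R : realType) (f : R -> R) (K : R) :
  continuous f -> (forall x, `|f x| <= K) -> bmeas f.
Proof. by move=> cf fK; split; [exact: continuous_measurable_fun|exists K]. Qed.

Lemma bmeasD (R : realType) (f g : R -> R) : bmeas f -> bmeas g -> bmeas (fun x => f x + g x).
Proof.
move=> [mf [K fK]] [mg [L gL]]; split; first exact: measurable_funD.
by exists (K + L) => x; rewrite (le_trans (ler_normD _ _))// lerD.
Qed.

Lemma bmeasZ (R : realType) (c : R) (f : R -> R) : bmeas f -> bmeas (fun x => c * f x).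
Proof.
move=> [mf [K fK]]; split; first exact: measurable_funM.
by exists (`|c| * K) => x; rewrite normrM ler_wpM2l.
Qed.

Lemma bmeasB (R : realType) (f g : R -> R) : bmeas f -> bmeas g -> bmeas (fun x => f x - g x).
Proof.
move=> bf bg; have := bmeasD bf (bmeasZ (-1) bg).
by under eq_fun do rewrite mulN1r.
Qed.

Lemma bmeas_norm (R : realType) (f : R -> R) : bmeas f -> bmeas (fun x => `|f x|).
Proof.
move=> [mf [K fK]]; split; first exact: measurableT_comp.
by exists K => x; rewrite normr_id.
Qed.

Lemma bmeas_indic (R : realType) (A : set (measurableTypeR R)) : measurable A ->
  bmeas (\1_A : R -> R).
Proof.
move=> mA; split; first exact: measurable_indic.
by exists 1 => x; rewrite indicE; case: (x \in A); rewrite ?normr1 ?normr0.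
Qed.

Section L1Density.
Variables (R : realType) (d1 d2 : measure_display) (T1 : measurableType d1) (T2 : measurableType d2).
Variables (P1 : probability T1 R) (P2 : probability T2 R) (Y1 : T1 -> R) (Y2 : T2 -> R).
Hypotheses (mY1 : measurable_fun setT Y1) (mY2 : measurable_fun setT Y2).
Local Notation TR := (measurableTypeR R).

Definition mean2 f := mean P1 Y1 f + mean P2 Y2 f.

Lemma mean2_le f g : bmeas f -> bmeas g -> (forall x, f x <= g x) -> mean2 f <= mean2 g.
Proof. by move=> bf bg fg; apply: lerD; apply: mean_le. Qed.

Lemma mean2D f g : bmeas f -> bmeas g -> mean2 (fun x => f x + g x) = mean2 f + mean2 g.
Proof. by move=> bf bg; rewrite /mean2 !meanD//; ring. Qed.

Lemma mean2Z c f : bmeas f -> mean2 (fun x => c * f x) = c * mean2 f.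
Proof. by move=> bf; rewrite /mean2 !meanZ//; ring. Qed.

Lemma mean2_cst c : mean2 (fun _ => c) = 2 * c.
Proof. by rewrite /mean2 !mean_cst; ring. Qed.

Lemma mean2_small (f : nat -> R -> R) (e : R) : 0 < e -> (forall n, measurable_fun setT (f n)) ->
  (forall n x, `|f n x| <= 1) -> (forall x, f n x @[n --> \oo] --> (0 : R)) ->
  exists n, mean2 (f n) <= e.
Proof.
move=> e0 mf f1 f0.
have h : mean2 (f n) @[n --> \oo] --> (0 : R).
  by rewrite -[X in _ --> X](addr0 0); apply: cvgD; exact: mean_cvg0.
have /cvgrPdist_le /(_ e e0) [n _ /(_ n (leqnn n))] := h.
by rewrite sub0r normrN => le_e; exists n; rewrite (le_trans (ler_norm _)).
Qed.

(** One phi approximates f under both laws at once, and its range in [0, 1] preserves the sup bound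
    after rescaling. *)
Definition approx (f : R -> R) := forall e : R, 0 < e ->
  exists phi : R -> R, [/\ continuous phi, forall x, 0 <= phi x <= 1 &
    mean2 (fun x => `|f x - phi x|) <= e].

Let b01 (phi : R -> R) : continuous phi -> (forall x, 0 <= phi x <= 1) -> bmeas phi.
Proof.
move=> cphi phi01; apply: (@bmeas_continuous _ _ 1) => // x.
by rewrite ler_norml; have /andP[a b] := phi01 x; rewrite b (le_trans _ a).
Qed.

(** Ramps of slope n starting at a converge pointwise to the indicator, also at a because the ray is
    open. *)
Lemma approx_ray (a : R) : approx (\1_(`]a, +oo[%classic : set R)).
Proof.
move=> e e0.
pose phi (n : nat) (x : R) := Num.min 1 (n%:R * Num.max 0 (x - a)).
have cphi n : continuous (phi n).
  move=> x; apply: (@continuous_min R R (cst 1) (fun x => n%:R * Num.max 0 (x - a))); first exact: cst_continuous.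
  apply: cvgM; first exact: cvg_cst.
  apply: (@continuous_max R R (cst 0) (fun x => x - a)); first exact: cst_continuous.
  by apply: cvgB; [exact: cvg_id|exact: cvg_cst].
have phi01 n x : 0 <= phi n x <= 1.
  by rewrite /phi ge_min lexx /= le_min ler01 mulr_ge0// le_max lexx.
have bi : bmeas (\1_(`]a, +oo[%classic : set R) : R -> R) by apply: bmeas_indic; exact: measurable_itv.
have [n le_e] : exists n, mean2 (fun x => `|\1_(`]a, +oo[%classic : set R) x - phi n x|) <= e.
  apply: (@mean2_small (fun n x => `|\1_(`]a, +oo[%classic : set R) x - phi n x|)) => //.
  - by move=> n; have [] := bmeas_norm (bmeasB bi (b01 (cphi n) (phi01 n))).
  - move=> n x; rewrite normr_id indicE; have /andP[p0 p1] := phi01 n x.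
    by rewrite ler_norml; case: (x \in _) => /=; apply/andP; split; lra.
  - move=> x; apply: cvg_near_cst; rewrite indicE.
    have [xa|ax] := leP x a.
      apply: nearW => n; rewrite memNset /=; last by rewrite in_itv/= andbT ltNge xa.
      by rewrite /phi max_l ?subr_le0// mulr0 min_r// subr0 normr0.
    near=> n; rewrite mem_set /=; last by rewrite in_itv/= andbT.
    rewrite /phi max_r; last by rewrite subr_ge0 ltW.
    rewrite min_l ?subrr ?normr0// -ler_pdivrMr ?subr_gt0//.
    by near: n; exact: nbhs_infty_ger.
by exists (phi n).
Unshelve. all: by end_near. Qed.

Lemma approxC (A : set R) : measurable (A : set TR) -> approx (\1_A) -> approx (\1_(~` A)).
Proof.
move=> mA aA e e0; have [phi [cphi phi01 le_e]] := aA e e0.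
exists (fun x => 1 - phi x); split.
- by move=> x; apply: cvgB; [exact: cvg_cst|exact: cphi].
- by move=> x; have /andP[a b] := phi01 x; apply/andP; split; lra.
- rewrite (_ : (fun _ => _) = (fun x => `|\1_A x - phi x|))//; apply/funext => x.
  rewrite distrC !indicE in_setC; case: (x \in A) => /=; congr (`| _ |); ring.
Qed.

(** The maximum of the two approximants works, its error being at most the sum of theirs. *)
Lemma approxU (A B : set R) : measurable (A : set TR) -> measurable (B : set TR) ->
  approx (\1_A) -> approx (\1_B) -> approx (\1_(A `|` B)).
Proof.
move=> mA mB aA aB e e0; have e20 : 0 < e / 2 by rewrite divr_gt0.
have [phi [cphi phi01 le_phi]] := aA _ e20; have [psi [cpsi psi01 le_psi]] := aB _ e20.
have cm : continuous (fun x => Num.max (phi x) (psi x)).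
  by move=> x; apply: (@continuous_max R R phi psi); [exact: cphi|exact: cpsi].
have m01 x : 0 <= Num.max (phi x) (psi x) <= 1.
  by have /andP[a b] := phi01 x; have /andP[a' b'] := psi01 x; rewrite le_max ge_max a b b'.
exists (fun x => Num.max (phi x) (psi x)); split=> //.
have b1 : bmeas (fun x => `|\1_A x - phi x|).
  by apply/bmeas_norm/bmeasB; [exact: bmeas_indic|exact: b01].
have b2 : bmeas (fun x => `|\1_B x - psi x|).
  by apply/bmeas_norm/bmeasB; [exact: bmeas_indic|exact: b01].
rewrite (@le_trans _ _ (mean2 (fun x => `|\1_A x - phi x| + `|\1_B x - psi x|)))//.
  apply: mean2_le; [|exact: bmeasD|].
    apply/bmeas_norm/bmeasB; last exact: b01.
    by apply: bmeas_indic; exact: measurableU.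
  move=> x; rewrite !indicE in_setU; have /andP[a b] := phi01 x; have /andP[a' b'] := psi01 x.
  have n1 : `|1 - phi x| = 1 - phi x by rewrite ger0_norm// subr_ge0.
  have n2 : `|1 - psi x| = 1 - psi x by rewrite ger0_norm// subr_ge0.
  have n3 : `|0 - phi x| = phi x by rewrite sub0r normrN ger0_norm.
  have n4 : `|0 - psi x| = psi x by rewrite sub0r normrN ger0_norm.
  by case: (x \in A) => /=; case: (x \in B) => /=; case: (leP (phi x) (psi x)) => h;
    rewrite ?n1 ?n2 ?n3 ?n4; lra.
by rewrite mean2D// [leRHS]splitr lerD.
Qed.

(** The approximable measurable sets form a sigma-algebra containing the open rays, which generate.
    For countable unions, the finite partial unions converge pointwise, and dominated convergence
    reduces to one of them. *)
Lemma approx_measurable (A : set TR) : measurable A -> approx (\1_A).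
Proof.
pose G := [set A : set TR | measurable A /\ approx (\1_A)].
suff : measurable `<=` G by move=> /[apply] -[].
rewrite RGenOInfty.measurableE; apply: smallest_sub; last first.
  by move=> B [x ->]; split; [exact: measurable_itv|exact: approx_ray].
split.
- split => // e e0; exists (fun=> 0); split.
  + by move=> x; exact: cvg_cst.
  + by move=> x; rewrite lexx ler01.
  + rewrite (_ : (fun _ => _) = (fun=> 0)) ?mean2_cst ?mulr0 ?ltW//.
    by apply/funext => x; rewrite indic0 subr0 normr0.
- move=> B [mB aB]; rewrite setTD; split; first exact: measurableC.
  exact: approxC.
- move=> F GF.
  have mF n : measurable (F n) by case: (GF n).
  have mU : measurable (\bigcup_n F n) by exact: bigcup_measurable.
  split=> // e e0.
  pose H n := \big[setU/set0]_(k < n) F k.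
  have GH n : G (H n).
    elim: n => [|n [mHn aHn]]; rewrite /H.
      rewrite big_ord0; split => // e' e'0; exists (fun=> 0); split.
      + by move=> x; exact: cvg_cst.
      + by move=> x; rewrite lexx ler01.
      + rewrite (_ : (fun _ => _) = (fun=> 0)) ?mean2_cst ?mulr0 ?ltW//.
        by apply/funext => x; rewrite indic0 subr0 normr0.
    rewrite big_ord_recr /=; split; first exact: (measurableU _ _ mHn (mF n)).
    by apply: approxU => //; case: (GF n).
  have e20 : 0 < e / 2 by rewrite divr_gt0.
  have bU : bmeas (\1_(\bigcup_n F n) : R -> R) by exact: bmeas_indic.
  have bH n : bmeas (\1_(H n) : R -> R) by apply: bmeas_indic; case: (GH n).
  have [n le_n] : exists n, mean2 (fun x => `|\1_(\bigcup_n F n) x - \1_(H n) x|) <= e / 2.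
    apply: (@mean2_small (fun n x => `|\1_(\bigcup_n F n) x - \1_(H n) x|)) => //.
    + by move=> n; have [] := bmeas_norm (bmeasB bU (bH n)).
    + move=> n x; rewrite normr_id !indicE.
      by do 2 case: (x \in _); rewrite ?subr0 ?sub0r ?subrr ?normrN ?normr1 ?normr0.
    + move=> x; apply: cvg_near_cst; rewrite indicE.
      have [[k _ Fkx]|nU] := pselect ((\bigcup_n F n) x).
        near=> n; rewrite mem_set; last by exists k.
        rewrite indicE mem_set ?subrr ?normr0// /H.
        rewrite -bigcup_mkord; exists k => //=.
        by near: n; exact: nbhs_infty_gt.
      apply: nearW => n; rewrite memNset// indicE memNset ?subrr ?normr0//.
      by rewrite /H -bigcup_mkord => -[k _ Fkx]; apply: nU; exists k.
  have [_ /(_ _ e20) [phi [cphi phi01 le_phi]]] := GH n.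
  exists phi; split => //.
  have b1 := bmeas_norm (bmeasB bU (bH n)).
  have b2 := bmeas_norm (bmeasB (bH n) (b01 cphi phi01)).
  rewrite (@le_trans _ _ (mean2 (fun x => `|\1_(\bigcup_n F n) x - \1_(H n) x| + `|\1_(H n) x - phi x|)))//.
    apply: mean2_le; [|exact: bmeasD|by move=> x; exact: ler_distD].
    by apply/bmeas_norm/bmeasB => //; exact: b01.
  by rewrite mean2D// [leRHS]splitr lerD.
Unshelve. all: by end_near. Qed.

(** Counting the thresholds 1, ..., n not exceeding y gives the integer part of y; the difference is
    the fractional part. *)
Lemma layer_cake (n : nat) (y : R) : 0 <= y <= n%:R ->
  0 <= y - \sum_(k < n) (k.+1%:R <= y)%R%:R <= 1.
Proof.
elim: n => [|n IH] /andP[y0 yn].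
  by rewrite big_ord0 subr0 y0 (le_trans yn)// ler01.
rewrite big_ord_recr/=; have [nye|nye] := leP n.+1%:R y.
  have -> : y = n.+1%:R by apply/eqP; rewrite eq_le yn.
  rewrite (eq_bigr (fun=> 1)); last first.
    by move=> k _; rewrite ler_nat ltnS (ltnW (ltn_ord k)).
  by rewrite sumr_const card_ord -mulrSr subrr lexx ler01.
rewrite addr0; have [yn'|yn'] := leP y n%:R; first by apply: IH; rewrite y0.
rewrite (eq_bigr (fun=> 1)); last first.
  by move=> k _; rewrite (le_trans _ (ltW yn'))// ler_nat.
rewrite sumr_const card_ord; apply/andP; split; first by rewrite subr_ge0 ltW.
by rewrite lerBlDr addrC -mulrSr ltW.
Qed.

Lemma approx_bounded (f : R -> R) : measurable_fun setT f -> (forall x, 0 <= f x <= 1) -> approx f.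
Proof.
move=> mf f01 e e0.
(* As n >= 4/e, the discretization error, 1/n under each of the two laws, totals at most e/2. The n
   indicators cost e/2 each but enter with weight 1/n. *)
pose n := (Num.bound (4 / e)).+1.
have n0 : 0 < n%:R :> R by rewrite ltr0n.
have n_e : n%:R^-1 <= e / 4 :> R.
  rewrite -[e / 4]invrK lef_pV2 ?posrE ?invr_gt0 ?divr_gt0// invf_div.
  rewrite (le_trans (ltW (archi_boundP _)))// ?divr_ge0 ?ltW//.
  by rewrite /n ltr_nat.
pose A (k : 'I_n) := [set x : R | k.+1%:R <= n%:R * f x].
have mA k : measurable (A k : set TR).
  rewrite (_ : A k = (fun x => n%:R * f x) @^-1` `[k.+1%:R, +oo[%classic); last first.
    by apply/seteqP; split => x /=; rewrite in_itv/= andbT.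
  rewrite -[X in measurable X]setTI; apply: measurable_funM => //; exact: measurable_itv.
have e20 : 0 < e / 2 by rewrite divr_gt0.
have ex k : exists phi : R -> R, [/\ continuous phi, forall x, 0 <= phi x <= 1 &
    mean2 (fun x => `|\1_(A k) x - phi x|) <= e / 2].
  exact: (approx_measurable (mA k)).
have [phi phiP] := choice ex.
pose ph x := n%:R^-1 * \sum_k phi k x.
have cph : continuous ph.
  move=> x; apply: cvgM; first exact: cvg_cst.
  rewrite /=; move: (index_enum _) => r; elim: r => [|k r IH].
    by under eq_cvg do rewrite big_nil; rewrite big_nil; exact: cvg_cst.
  under eq_cvg do rewrite big_cons; rewrite big_cons; apply: cvgD IH.
  by have [c _ _] := phiP k; exact: c.
have ph01 x : 0 <= ph x <= 1.
  rewrite /ph mulr_ge0 ?invr_ge0//=; last first.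
    by apply: sumr_ge0 => k _; have [_ /(_ x) /andP[]] := phiP k.
  rewrite mulrC ler_pdivrMr// mul1r (_ : n%:R = \sum_(k < n) 1); last by rewrite sumr_const card_ord.
  by apply: ler_sum => k _; have [_ /(_ x) /andP[]] := phiP k.
exists ph; split=> //.
have bA k : bmeas (fun x => `|\1_(A k) x - phi k x|).
  by have [c1 c2 _] := phiP k; apply/bmeas_norm/bmeasB; [exact: bmeas_indic|exact: b01].
have bS (r : seq 'I_n) : bmeas (fun x => \sum_(k <- r) `|\1_(A k) x - phi k x|) /\
   mean2 (fun x => \sum_(k <- r) `|\1_(A k) x - phi k x|) <= (size r)%:R * (e / 2).
  elim: r => [|k r [IH1 IH2]].
    split; last by under eq_fun do rewrite big_nil; rewrite mean2_cst mulr0 mul0r.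
    by under eq_fun do rewrite big_nil; apply: (@bmeas_continuous _ _ 0) => x; [exact: cvg_cst|rewrite normr0].
  split; first by under eq_fun do rewrite big_cons; exact: bmeasD.
  under eq_fun do rewrite big_cons; rewrite mean2D//= -natr1 mulrDl mul1r addrC lerD//.
  by have [_ _] := phiP k.
have [bS1 bS2] := bS (index_enum 'I_n).
have c2 : bmeas (fun _ : R => n%:R^-1).
  by apply: (@bmeas_continuous _ _ `|n%:R^-1|) => // x; exact: cvg_cst.
have bf : bmeas f.
  by split => //; exists 1 => x; rewrite ler_norml; have /andP[a b] := f01 x; rewrite b (le_trans _ a).
rewrite (@le_trans _ _ (mean2 (fun x => n%:R^-1 + n%:R^-1 * \sum_k `|\1_(A k) x - phi k x|)))//.
  apply: mean2_le; [by apply/bmeas_norm/bmeasB => //; exact: b01| |].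
    by apply: bmeasD => //; exact: bmeasZ.
  move=> x; have nf : 0 <= n%:R * f x <= n%:R.
    by have /andP[a b] := f01 x; rewrite mulr_ge0//= ler_piMr.
  have lc := layer_cake nf.
  have -> : f x - ph x = n%:R^-1 * (n%:R * f x - \sum_(k < n) (k.+1%:R <= n%:R * f x)%R%:R)
      + n%:R^-1 * (\sum_k (\1_(A k) x - phi k x)).
    rewrite -mulrDr sumrB /ph [X in _ + (X - _)](_ : _ = \sum_(k < n) (k.+1%:R <= n%:R * f x)%R%:R); last first.
      by apply: eq_bigr => k _; rewrite indicE; congr (nat_of_bool _)%:R; apply/idP/idP; rewrite inE.
    by rewrite addrA subrK mulrBr mulrA mulVf ?mul1r// gt_eqF.
  rewrite (le_trans (ler_normD _ _))// lerD//.
    rewrite normrM ger0_norm ?invr_ge0// ler_piMr ?invr_ge0//.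
    by case/andP: lc => l0 l1; rewrite ger0_norm.
  by rewrite normrM ger0_norm ?invr_ge0// ler_wpM2l ?invr_ge0// ler_norm_sum.
rewrite mean2D//; last exact: bmeasZ.
rewrite mean2_cst mean2Z// [leRHS]splitr lerD//.
  by rewrite (le_trans (ler_wpM2l _ n_e))//; lra.
rewrite mulrC ler_pdivrMr// (le_trans bS2)//.
by rewrite /index_enum -enumT size_enum_ord mulrC.
Qed.

(** The affine map from [-M, M] to [0, 1] and its inverse turn an approximant into a continuous
    function with the same bound M, so B is not degraded; the approximation error is arbitrarily
    small. *)
Lemma tv_extend (B : R) :
  (forall (v : R -> R) (M : R), continuous v -> (forall x, `|v x| <= M) ->
    `|mean P1 Y1 v - mean P2 Y2 v| <= B * M) ->
  forall (u : R -> R) (M : R), measurable_fun setT u -> (forall x, `|u x| <= M) ->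
    `|mean P1 Y1 u - mean P2 Y2 u| <= B * M.
Proof.
move=> hc u M mu uM; have M0 : 0 <= M by rewrite (le_trans _ (uM 0)).
(* The rescaling divides by 2 M, so the zero function is treated apart. *)
have [M00|Mn0] := eqVneq M 0.
  apply: hc => //; rewrite (_ : u = fun=> 0); first by move=> x; exact: cvg_cst.
  by apply/funext => x; apply/eqP; rewrite -normr_le0 -M00.
have Mp : 0 < M by rewrite lt_neqAle eq_sym Mn0.
apply/ler_addgt0Pr => e e0.
pose f x := (u x + M) / (2 * M).
have f01 x : 0 <= f x <= 1.
  have := uM x; rewrite ler_norml => /andP[a b].
  rewrite /f divr_ge0 ?mulr_ge0//=; last by lra.
  by rewrite ler_pdivrMr ?mulr_gt0// mul1r; lra.
have mf : measurable_fun setT f by apply: measurable_funM => //; exact: measurable_funD.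
have e20 : 0 < e / (2 * M) by rewrite divr_gt0 ?mulr_gt0.
have [phi [cphi phi01 le_phi]] := approx_bounded mf f01 e20.
pose v x := 2 * M * phi x - M.
have cv : continuous v.
  move=> x; apply: cvgB; last exact: cvg_cst.
  by apply: cvgM; [exact: cvg_cst|exact: cphi].
have vM x : `|v x| <= M.
  have /andP[a b] := phi01 x; rewrite ler_norml /v; apply/andP; split; first by nra.
  nra.
have bu : bmeas u by split => //; exists M.
have bv : bmeas v by exact: bmeas_continuous vM.
have bd := bmeas_norm (bmeasB bu bv).
have uv x : `|u x - v x| = 2 * M * `|f x - phi x|.
  rewrite -[X in X * _]ger0_norm ?mulr_ge0// -normrM; congr (`| _ |).
  by rewrite /f /v; field.
have D : mean2 (fun x => `|u x - v x|) <= e.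
  under eq_fun do rewrite uv.
  rewrite mean2Z; last by apply/bmeas_norm/bmeasB; [split=> //; exists 1 => x; rewrite ler_norml; have /andP[a b] := f01 x; rewrite b (le_trans _ a)|exact: b01].
  by rewrite mulrC -ler_pdivlMr ?mulr_gt0.
have near_mean d0 (T0 : measurableType d0) (P0 : probability T0 R) (Y0 : T0 -> R) :
    measurable_fun setT Y0 -> `|mean P0 Y0 u - mean P0 Y0 v| <= mean P0 Y0 (fun x => `|u x - v x|).
  move=> mY0; have -> : mean P0 Y0 u - mean P0 Y0 v = mean P0 Y0 (fun x => u x - v x).
    by rewrite /mean -RintegralB//; exact: bmeas_integrable.
  by apply: le_normr_Rintegral => //; apply: (bmeas_integrable P0 mY0 (bmeasB bu bv)).
have h1 := near_mean _ _ P1 _ mY1; have h2 := near_mean _ _ P2 _ mY2.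
have h3 := hc v M cv vM; rewrite /mean2 in D.
move: h1 h2 h3 D; move: (mean P1 Y1 u) (mean P1 Y1 v) (mean P2 Y2 u) (mean P2 Y2 v).
move=> a b c d'; rewrite !ler_norml => /andP[? ?] /andP[? ?] /andP[? ?] ?.
by apply/andP; split; lra.
Qed.

End L1Density.

(** * The Stein bound and the density argument combined for bounded measurable u *)

Lemma le_supnorm (R : realType) (u : R -> R) : (exists M : R, forall x, `|u x| <= M) ->
  forall x, `|u x| <= supnorm u.
Proof.
move=> [M uM] x; apply: ub_le_sup; last by exists x.
by exists M => _ [y _ <-].
Qed.

Theorem theorem1p7 (R : realType) (beta h q C0 : R) :
  0 < beta -> 0 < q < 1 ->
  (forall N : nat, (0 < N)%N ->
     @disE R N (fun g => avg2 beta h g (fun s1 s2 => (@overlap R N s1 s2 - q) ^+ 4))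
       <= C0 / (N%:R ^+ 2)) ->
  exists C : R, forall (N : nat) (i : 'I_N) (u : R -> R),
    measurable_fun [set: R] u ->
    (exists M : R, forall x, `|u x| <= M) ->
    `| @disE R N (fun g => u (cavity_r beta h q g i))
       - gaussE (fun z => u (z * Num.sqrt q)) |
      <= C * supnorm u / (N%:R `^ (4^-1)).
Proof.
move=> beta_gt0 q01 overlap4.
have q0 : 0 < q by case/andP: q01.
have [CS CS0 stein] := @stein_solution R.
exists (CS * Cstein beta q C0) => N i u mu bu.
have N_gt0 : (0 < N)%N by case: i => m; exact: leq_ltn_trans.
have p_gt0 : 0 < N%:R `^ (4^-1) :> R by rewrite powR_gt0// ltr0n.
pose e : R := (N%:R `^ (4^-1))^-1.
have e_gt0 : 0 < e by rewrite invr_gt0.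
have eN : e ^+ 4 * N%:R = 1.
  rewrite exprVn -powR_mulrn ?powR_ge0// -powRrM mulVf// powRr1//.
  by rewrite mulVf// pnatr_eq0 -lt0n.
have sq_gt0 : 0 < Num.sqrt q by rewrite sqrtr_gt0.
(* A concrete probability space is fixed so that Y has a law to compare with the normal one. *)
have [d [T [P [X [mX rep]]]]] := @disE_rep R N.
pose Y (g : 'I_N -> 'I_N -> R) := cav beta h q i g / Num.sqrt q.
have rY : regular Y.
  apply: regularM; last exact: regular_cst.
  apply: regularB; first exact: regular_fld1.
  by apply: regularM; [exact: regular_cst|exact: regular_ci].
have mY : measurable_fun setT (fun t => Y (X t)) by exact: rY.1.
have mid : measurable_fun setT (@idfun R) by exact: measurable_id.
have meanE (v : R -> R) (M : R) : measurable_fun setT v -> (forall x, `|v x| <= M) ->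
    disE (fun g => v (Y g)) = mean P (fun t => Y (X t)) v.
  move=> mv vM; apply: (rep _ _).2; apply: (@regular_bounded _ _ _ M) => // d' T' X' mX'.
  by apply: measurableT_comp => //; exact: rY.1.
have gaussEE (v : R -> R) (M : R) : measurable_fun setT v -> (forall x, `|v x| <= M) ->
    gaussE v = mean (@normal_prob R 0 1) (@idfun R) v.
  move=> mv vM; apply: gaussE_int => //.
  by apply: (@bmeas_integrable _ _ _ (@normal_prob R 0 1) (@idfun R) mid v); split=> //; exists M.
(* Rescaling by sqrt q keeps the sup bound and makes the target a standard Gaussian. *)
pose v x := u (x * Num.sqrt q).
have mv : measurable_fun setT v.
  by apply: measurableT_comp => //; exact: measurable_funM.
have vM x : `|v x| <= supnorm u by exact: (le_supnorm bu).
have -> : (fun g => u (cavity_r beta h q g i)) = (fun g => v (Y g)).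
  by apply/funext => g; rewrite /v /Y cavE divfK// gt_eqF.
rewrite -/v (meanE _ _ mv vM) (gaussEE _ _ mv vM) -/e mulrAC.
rewrite (_ : _ / _ = CS * Cstein beta q C0 * e)//.
(* Only continuous test functions remain, with a constant proportional to their bound; for these a
   Stein solution with continuous derivative exists. *)
have tv := @tv_extend R _ _ _ _ P (@normal_prob R 0 1) _ _ mY mid (CS * Cstein beta q C0 * e).
apply: (tv _ v _ mv vM) => f M cf fM.
have mf : measurable_fun setT f by exact: continuous_measurable_fun.
rewrite -(meanE _ _ mf fM) -(gaussEE _ _ mf fM).
have [sf [dsf [der cd sfM dsfM eqn]]] := stein f M cf fM.
have := stein_cavity i beta_gt0 q01 e_gt0 eN (overlap4 N N_gt0) der cd sfM dsfM.
have -> : (fun g => dsf (cav beta h q i g / Num.sqrt q) -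
    cav beta h q i g / Num.sqrt q * sf (cav beta h q i g / Num.sqrt q)) = (fun g => f (Y g) - gaussE f).
  by apply/funext => g; rewrite eqn.
rewrite disEB ?disE_cst; last exact: regular_cst.
  by rewrite (_ : CS * M * _ * e = CS * Cstein beta q C0 * e * M)//; ring.
apply: (@regular_bounded _ _ _ M) => // d' T' X' mX'.
by apply: measurableT_comp => //; exact: rY.1.
Qed.
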